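(* Let $d\ge 1$ be an integer, and let $(\mathbf{X}_n)_{n\ge 0}$ be the $d$-dimensional Friedman random walk. State $\mathbf{0}=(0,\ldots,0)$ is recurrent if $d=1$ or $d=2$, and is transient if $d\ge 3$.
   Context: Friedman urn: an urn initially contains one white ball and no blue balls. At each unit of discrete time a ball is drawn uniformly at random from the urn and is returned to the urn together with one additional ball of the opposite color. Let $W_n$ and $B_n$ be the numbers of white and blue draws among the first $n$ draws, so $W_n+B_n=n$; after $n$ draws the urn contains $B_n+1$ white balls and $W_n$ blue balls. One-dimensional Friedman random walk: a particle starts at the origin, $X_0=0$, and after each draw moves by $+1$ if the drawn ball is white and by $-1$ if it is blue, so $X_n=W_n-B_n\in\mathbb{Z}$. $d$-dimensional Friedman random walk: $\mathbf{X}_n=(X_n^{(1)},\ldots,X_n^{(d)})$, where $X_n^{(1)},\ldots,X_n^{(d)}$ are independent one-dimensional Friedman random walks, each driven by its own independent Friedman urn. Thus all coordinates change by $\pm1$ at each step. Recurrence: a state is recurrent if the particle's probability of returning to it infinitely often is $1$; a state that is not recurrent is transient. *)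

(* Defs.v *)
From HB Require Import structures.
From mathcomp Require Import all_boot all_order all_algebra.
From mathcomp Require Import all_classical all_reals all_analysis.

Set Implicit Arguments.
Unset Strict Implicit.
Unset Printing Implicit Defensive.

Import Order.TTheory GRing.Theory Num.Theory.

Local Open Scope classical_set_scope.
Local Open Scope ring_scope.

(* Draws are encoded as booleans: true is a white ball, false is a blue one.
   The contents of an urn are a pair (number of white, number of blue balls). *)

Definition urn0 : nat * nat := (1%N, 0%N).

Definition urn_step (u : nat * nat) (c : bool) : nat * nat :=
  if c then (u.1, u.2.+1) else (u.1.+1, u.2).

Definition urn_after (h : seq bool) : nat * nat := foldl urn_step urn0 h.

Lemma urn_afterE (h : seq bool) :
  urn_after h = ((count negb h).+1, count id h).
Proof.
elim/last_ind: h => [//|h c IHh].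
rewrite /urn_after foldl_rcons -/(urn_after h) IHh -cats1 !count_cat /=.
by case: c; rewrite /= ?addn0 ?addn1.
Qed.

Section FriedmanUrn.
Context {R : realType} {disp : measure_display} {T : measurableType disp}.
Implicit Types (P : probability T R) (D : nat -> T -> bool).

(* The first n draws; D k is the result of draw number k + 1. *)
Definition history D (n : nat) (w : T) : seq bool := mkseq (D ^~ w) n.

Definition white_draws D (n : nat) (w : T) : nat := count id (history D n w).

Definition blue_draws D (n : nat) (w : T) : nat := count negb (history D n w).

(* The draw law is P(next ball is white | history = h) = white / (white + blue),
   multiplied out by P(history = h) so that null histories are harmless. *)
Record friedman_urn P D : Prop := FriedmanUrn {
  friedman_urn_measurable : forall n, measurable_fun [set: T] (D n) ;
  friedman_urn_law : forall h : seq bool,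
    let u := urn_after h in
    let H := [set w | history D (size h) w = h] in
    (P (H `&` [set w | D (size h) w]) =
      P H * (u.1%:R / (u.1 + u.2)%:R : R)%:E)%E }.

Definition sigma_process D : set (set T) :=
  <<s \bigcup_n preimage_set_system [set: T] (D n) measurable >>.

Definition mutually_independent P (I : finType) (G : I -> set (set T)) : Prop :=
  forall (J : {set I}) (A : I -> set T), (forall i, i \in J -> G i (A i)) ->
    P (\bigcap_(i in [set` J]) A i) = (\big[*%E/1%E]_(i in J) P (A i))%E.

Definition friedman_urns P (d : nat) (D : 'I_d -> nat -> T -> bool) : Prop :=
  (forall i, friedman_urn P (D i)) /\
  mutually_independent P (fun i => sigma_process (D i)).

Definition walk1 D (n : nat) (w : T) : int :=
  (white_draws D n w)%:Z - (blue_draws D n w)%:Z.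

Definition walk (d : nat) (D : 'I_d -> nat -> T -> bool) (n : nat) (w : T) :
  'rV[int]_d := \row_i walk1 (D i) n w.

(* lim_sup_set is the event that infinitely many of the given events occur. *)
Definition recurrent P (S : Type) (X : nat -> T -> S) (s : S) : Prop :=
  P (lim_sup_set (fun n => [set w | X n w = s])) = 1%E.

Definition transient P (S : Type) (X : nat -> T -> S) (s : S) : Prop :=
  ~ recurrent P X s.

End FriedmanUrn.

(* Main.v *)
Require Import Defs.
From mathcomp Require Import all_boot all_order all_algebra.
From mathcomp Require Import all_classical all_reals all_analysis.
From mathcomp Require Import ring lra zify.
Set Implicit Arguments.
Unset Strict Implicit.
Unset Printing Implicit Defensive.
Import Order.TTheory GRing.Theory Num.Theory.
Import numFieldNormedType.Exports.
Local Open Scope ring_scope.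

(** Why the theorem holds. The number [w] of white draws of one urn is an
    inhomogeneous Markov chain: after [n] draws the next one is white with
    probability [(n + 1 - w) / (n + 1)], and the coordinate [2 * w - n] of the
    walk is at the origin when [2 * w = n]. One coordinate has variance of
    order [n], so it is at the origin at an even time [n] with probability of
    order [1 / sqrt n], and [d] independent coordinates are there together
    with probability of order [n ^ (- d / 2)]. This is summable exactly when
    [d >= 3].

    The local estimate is obtained without a local limit theorem. The law of
    [w] stays symmetric and log-concave ([push_symmetric],
    [push_log_concave]), and its second moment is known exactly
    ([plaw_second_moment]). For such a law the value at the mode is comparable
    to the inverse of the standard deviation: an upper bound comes from the
    geometric decay of log-concave tails ([bell_center_upper]), a lower bound
    from Chebyshev's inequality ([bell_center_lower]). The same upper bound
    holds for returns from the origin at an even time [j] to the origin at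
    time [k], with [k - j] in place of [n].

    For [d >= 3] the first Borel-Cantelli lemma concludes ([transient3]).

    For [d = 2] the expected number of visits between two large times and the
    expected number of visits after a visit are both of logarithmic size, so
    decomposing at the first visit ([visits_le_hit]) shows that, from the
    initial urns, a visit after any given time has probability at least a
    fixed constant. Zero-one arguments are replaced by an explicit loss of
    memory: white draws make further white draws less likely, so one draw
    multiplies the Lipschitz constant of the mean of a function of the state
    by [n / (n + 1)] ([expect_contract]), and these factors multiply to [0].
    Hence the lower bound on the hitting probability holds from every state at
    every time ([avoid2_uniform]); repeating it over successive blocks of time,
    the walk returns almost surely after every time ([visits_io]). For [d = 1]
    the walk visits the origin at least as often as a walk in the plane of
    which it is a coordinate ([avoid1_le_avoid2]). *)

(** * Hitting a target by an inhomogeneous chain *)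

Section Chain.
Context {R : realFieldType} {E : finType} {S : Type}.
(** In state [s] at time [n] the draw is [c] with probability [kappa n s c] and
    leads to the state [next s c]. *)
Variables (kappa : nat -> S -> E -> R) (next : S -> E -> S).
Variable (target : nat -> S -> bool).

Definition expect n (g : S -> R) s := \sum_c kappa n s c * g (next s c).

Fixpoint expect_iter k n (g : S -> R) s :=
  if k is k'.+1 then expect n (expect_iter k' n.+1 g) s else g s.

(** The times that count are [n + 1, ..., n + k]: the present is left out. *)
Fixpoint avoid k n s :=
  if k is k'.+1 then
    expect n (fun t => if target n.+1 t then 0 else avoid k' n.+1 t) s
  else 1.

Fixpoint visits k n s :=
  if k is k'.+1 then
    expect n (fun t => (target n.+1 t)%:R + visits k' n.+1 t) s
  else 0.

Hypothesis kappa_ge0 : forall n s c, 0 <= kappa n s c.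
Hypothesis kappa_sum1 : forall n s, \sum_c kappa n s c = 1.

Lemma eq_expect n g h s : g =1 h -> expect n g s = expect n h s.
Proof. by move=> gh; apply: eq_bigr => c _; rewrite gh. Qed.

Lemma expect_le n g h s : (forall c, g (next s c) <= h (next s c)) ->
  expect n g s <= expect n h s.
Proof. by move=> gh; apply: ler_sum => c _; apply: ler_wpM2l. Qed.

Lemma expectD n g h s :
  expect n (fun t => g t + h t) s = expect n g s + expect n h s.
Proof. by rewrite /expect -big_split; apply: eq_bigr => c _;
  rewrite mulrDr. Qed.

Lemma expectMr n g (a : R) s :
  expect n (fun t => g t * a) s = expect n g s * a.
Proof. by rewrite /expect mulr_suml; apply: eq_bigr => c _; rewrite mulrA. Qed.

Lemma expect_cst n (a : R) s : expect n (fun=> a) s = a.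
Proof. by rewrite /expect -mulr_suml kappa_sum1 mul1r. Qed.

Lemma expect_sum n I (r : seq I) (F : I -> S -> R) s :
  expect n (fun t => \sum_(i <- r) F i t) s = \sum_(i <- r) expect n (F i) s.
Proof.
elim: r => [|i r IH].
  by rewrite big_nil -[RHS](expect_cst n 0 s); apply: eq_expect => t;
    rewrite big_nil.
by rewrite big_cons -IH -expectD; apply: eq_expect => t; rewrite big_cons.
Qed.

Lemma eq_expect_iter k n g h s : g =1 h ->
  expect_iter k n g s = expect_iter k n h s.
Proof.
move=> gh; elim: k n s => [|k IH] n s //=.
by apply: eq_expect => t; apply: IH.
Qed.

Lemma expect_iterMr k n g (a : R) s :
  expect_iter k n (fun t => g t * a) s = expect_iter k n g s * a.
Proof.
elim: k n s => [|k IH] n s //=; rewrite -expectMr.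
by apply: eq_expect => t; apply: IH.
Qed.

Lemma expect_iterD k n g h s :
  expect_iter k n (fun t => g t + h t) s
  = expect_iter k n g s + expect_iter k n h s.
Proof.
elim: k n s => [|k IH] n s //=; rewrite -expectD.
by apply: eq_expect => t; apply: IH.
Qed.

Lemma expect_iter_cst k n (a : R) s : expect_iter k n (fun=> a) s = a.
Proof.
elim: k n s => [|k IH] n s //=; rewrite -[RHS](expect_cst n a s).
by apply: eq_expect => t; apply: IH.
Qed.

Lemma expect_iter_sum k n I (r : seq I) (F : I -> S -> R) s :
  expect_iter k n (fun t => \sum_(i <- r) F i t) s
  = \sum_(i <- r) expect_iter k n (F i) s.
Proof.
elim: k n s => [|k IH] n s //=; rewrite -expect_sum.
by apply: eq_expect => t; apply: IH.
Qed.

Lemma expect_iter_comp a b n g s :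
  expect_iter (a + b) n g s = expect_iter a n (expect_iter b (a + n) g) s.
Proof.
elim: a n s => [|a IH] n s //=.
by apply: eq_expect => t; rewrite IH addnS.
Qed.

Lemma expect_iter_ge0 k n g s : (forall t, 0 <= g t) -> 0 <= expect_iter k n g
  s.
Proof.
move=> g0; elim: k n s => [|k IH] n s //=.
by apply: sumr_ge0 => c _; apply: mulr_ge0.
Qed.

(** Only states that can be reached matter: [valid n] is a set of states in
    which the chain stays once it is there. *)
Variable valid : nat -> S -> Prop.
Hypothesis valid_next : forall n s c, valid n s -> valid n.+1 (next s c).

Lemma expect_iter_le k n g h s : valid n s ->
  (forall t, valid (k + n) t -> g t <= h t) ->
  expect_iter k n g s <= expect_iter k n h s.
Proof.
elim: k n s => [|k IH] n s vs gh //=; first exact: gh.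
apply: expect_le => c; apply: IH; first exact: valid_next.
by rewrite addnS.
Qed.

Lemma avoid_ge0 k n s : 0 <= avoid k n s.
Proof.
elim: k n s => [|k IH] n s //=.
by apply: sumr_ge0 => c _; apply: mulr_ge0 => //; case: ifP.
Qed.

Lemma avoid_le1 k n s : avoid k n s <= 1.
Proof.
elim: k n s => [|k IH] n s //=.
rewrite -[leRHS](expect_cst n 1 s).
by apply: expect_le => c; case: ifP.
Qed.

(** Decomposition at the first visit. If [G] bounds the expected number of
    visits counted from a visit (itself included), then the expected number
    of visits is at most [G] times the probability of visiting at all: this is
    how a lower bound on hitting probabilities comes out of first moments. *)
Lemma visits_le_hit (G : R) k n s : 0 <= G ->
  (forall i t, (i < k)%N -> target (n + k - i) t ->
     1 + visits i (n + k - i) t <= G) ->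
  visits k n s <= (1 - avoid k n s) * G.
Proof.
move=> G0; elim: k n s => [|k IH] n s HG /=; first by rewrite subrr mul0r.
have -> : (1 - expect n (fun t => if target n.+1 t then 0
      else avoid k n.+1 t) s) * G
    = expect n (fun t => if target n.+1 t then G
      else (1 - avoid k n.+1 t) * G) s.
  have -> : 1 - expect n (fun t => if target n.+1 t then 0
      else avoid k n.+1 t) s = expect n (fun t => if target n.+1 t then 1
      else 1 - avoid k n.+1 t) s.
    apply/eqP; rewrite subr_eq -expectD -[X in X == _](expect_cst n 1 s).
    by apply/eqP/eq_expect => t; case: ifP; rewrite ?addr0 ?subrK.
  rewrite -expectMr; apply: eq_expect => t.
  by case: ifP => _; rewrite ?mul1r.
apply: expect_le => c; case: ifP => [tc|_].
  have e : (n + k.+1 - k = n.+1)%N by lia.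
  by move: (HG k (next s c) (ltnSn k)); rewrite e; apply.
rewrite add0r; apply: IH => i t ik; rewrite addSnnS; apply: HG.
exact: ltnW.
Qed.

(** Not watching the first [a] steps can only make avoidance more likely. *)
Lemma avoid_skip a b n s :
  avoid (a + b) n s <= expect_iter a n (avoid b (a + n)) s.
Proof.
elim: a n s => [|a IH] n s //=.
apply: expect_le => c.
case: ifP => _.
  by apply: expect_iter_ge0 => t; apply: avoid_ge0.
by rewrite addSnnS; apply: IH.
Qed.

Lemma avoid_mul a b n s (x : R) : valid n s -> 0 <= x ->
  (forall t, valid (a + n) t -> avoid b (a + n) t <= x) ->
  avoid (a + b) n s <= avoid a n s * x.
Proof.
move=> + x0; elim: a n s => [|a IH] n s vs Hx /=.
  by rewrite mul1r; exact: Hx.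
rewrite -expectMr; apply: expect_le => c.
case: ifP => _; first by rewrite mul0r.
apply: IH; first exact: valid_next.
by move=> t; rewrite addnS; exact: Hx.
Qed.

(** A hitting probability bounded below uniformly over the reachable states
    can be used again and again, over successive blocks of time. *)
Lemma avoid_geometric (x : R) : 0 <= x ->
  (forall n, exists k, forall s, valid n s -> avoid k n s <= x) ->
  forall r n, exists k, forall s, valid n s -> avoid k n s <= x ^+ r.
Proof.
move=> x0 H; elim=> [|r IH] n.
  by exists 0%N => s _; rewrite expr0.
have [a Ha] := H n; have [b Hb] := IH (a + n)%N.
exists (a + b)%N => s vs.
apply: le_trans (avoid_mul vs (exprn_ge0 r x0) Hb) _.
by rewrite exprS; apply: ler_wpM2r (Ha _ vs); rewrite exprn_ge0.
Qed.

Lemma visitsE k n s :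
  visits k n s =
  \sum_(i < k) expect_iter i.+1 n (fun t => (target (n + i.+1) t)%:R) s.
Proof.
elim: k n s => [|k IH] n s; first by rewrite big_ord0.
rewrite big_ord_recl /= -expect_sum -expectD.
apply: eq_expect => t; rewrite addn1 IH; congr (_ + _).
by apply: eq_bigr => i _; rewrite /bump add1n addSnnS.
Qed.

End Chain.

(** * The kernel of one urn *)

Section UrnKernel.
Context {R : realFieldType}.
Implicit Types (n w k j : nat) (g : nat -> R).

(** The state of an urn after [n] draws is the number [w] of white draws: the
    urn then holds [n + 1 - w] white balls out of [n + 1]. Truncated
    subtraction makes the kernel stochastic even at the impossible values
    of [w]. *)
Definition white_prob n w : R := (n.+1 - w)%:R / n.+1%:R.

Definition draw_prob n w (c : bool) : R :=
  if c then white_prob n w else 1 - white_prob n w.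

Definition count_draw w (c : bool) : nat := w + c.

Lemma white_prob_ge0 n w : 0 <= white_prob n w.
Proof. by rewrite /white_prob divr_ge0. Qed.

Lemma white_prob_le1 n w : white_prob n w <= 1.
Proof. by rewrite ler_pdivrMr ?ltr0n// mul1r ler_nat leq_subr. Qed.

Lemma draw_prob_ge0 n w c : 0 <= draw_prob n w c.
Proof.
by case: c; rewrite /draw_prob ?white_prob_ge0// subr_ge0 white_prob_le1.
Qed.

Lemma draw_prob_sum1 n w : \sum_c draw_prob n w c = 1.
Proof. by rewrite big_bool /= addrC subrK. Qed.

Local Notation K := (expect draw_prob count_draw).
Local Notation Kiter := (expect_iter draw_prob count_draw).

Lemma expect_urnE n g w :
  K n g w = white_prob n w * g w.+1 + (1 - white_prob n w) * g w.
Proof. by rewrite /expect big_bool /= /count_draw addn1 addn0. Qed.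

Lemma white_probE n w : (w <= n.+1)%N ->
  white_prob n w = (n.+1%:R - w%:R) / n.+1%:R.
Proof. by move=> wn; rewrite /white_prob natrB. Qed.

(** The chance of a white draw decreases with the number of white draws, so
    two neighbouring states merge at the next draw with probability
    [1 / (n + 1)]. *)
Lemma expect_contract n (x : R) g : 0 <= x ->
  (forall w, (w <= n.+1)%N -> `|g w.+1 - g w| <= x) ->
  forall w, (w <= n)%N -> `|K n g w.+1 - K n g w| <= n%:R / n.+1%:R * x.
Proof.
move=> x0 gx w wn; rewrite !expect_urnE.
have -> : white_prob n w.+1 * g w.+2 + (1 - white_prob n w.+1) * g w.+1 -
    (white_prob n w * g w.+1 + (1 - white_prob n w) * g w)
  = white_prob n w.+1 * (g w.+2 - g w.+1)
    + (1 - white_prob n w) * (g w.+1 - g w) by ring.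
have -> : n%:R / n.+1%:R = white_prob n w.+1 + (1 - white_prob n w).
  rewrite !white_probE//; last exact: ltnW.
  have n0 : n.+1%:R != 0 :> R by rewrite pnatr_eq0.
  have -> : n%:R = n.+1%:R - 1 :> R by rewrite -natr1 addrK.
  rewrite -(natr1 w); move: (n.+1%:R : R) n0 => N n0.
  by field.
apply: le_trans (ler_normD _ _) _; rewrite [leRHS]mulrDl (normrM (white_prob _
  _)) (normrM (1 - _)).
rewrite (ger0_norm (white_prob_ge0 _ _)).
rewrite (@ger0_norm _ (1 - _)) ?subr_ge0 ?white_prob_le1//.
by apply: lerD; apply: ler_wpM2l; rewrite ?white_prob_ge0 ?subr_ge0
  ?white_prob_le1 ?gx // leqW.
Qed.

(** The forward step, dual to [expect n] on functions of the state. *)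
Definition push n (p : nat -> R) w : R :=
  (if w is v.+1 then white_prob n v * p v else 0) + (1 - white_prob n w) * p w.

Fixpoint law k n (p : nat -> R) : nat -> R :=
  if k is k'.+1 then push (k' + n) (law k' n p) else p.

(** The value [w = n + 1] is allowed at time [n], so that the range of [w] is
    invariant under the symmetry [w |-> n + 1 - w] that exchanges colours. *)
Definition supported n (p : nat -> R) := forall w, (n.+1 < w)%N -> p w = 0.

Lemma push_supported n p : supported n p -> supported n.+1 (push n p).
Proof.
move=> sp [|w]//; rewrite ltnS => nw.
by rewrite /push (sp w)// (sp w.+1) ?mulr0 ?addr0// ltnW.
Qed.

Lemma push_expect n p g : supported n p ->
  \sum_(w < n.+2) p w * K n g w = \sum_(w < n.+3) push n p w * g w.
Proof.
move=> sp; under eq_bigr do rewrite expect_urnE mulrDr.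
rewrite big_split /=.
under [RHS]eq_bigr do rewrite mulrDl.
rewrite [RHS]big_split /=; congr (_ + _).
  rewrite [RHS]big_ord_recl /= mul0r add0r.
  by apply: eq_bigr => i _; rewrite /bump /= add1n mulrCA mulrA.
rewrite [RHS]big_ord_recr /= (sp n.+2)// mulr0 mul0r addr0.
by apply: eq_bigr => i _; rewrite mulrCA mulrA.
Qed.

Lemma law_supported k n p : supported n p -> supported (k + n) (law k n p).
Proof. by move=> sp; elim: k => [//|k IH]; apply: push_supported. Qed.

Lemma law_expect k n p g : supported n p ->
  \sum_(w < n.+2) p w * Kiter k n g w
  = \sum_(w < (k + n).+2) law k n p w * g w.
Proof.
move=> sp; elim: k g => [//|k IH] g.
have iterS w : Kiter k.+1 n g w = Kiter k n (K (k + n) g) w.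
  by rewrite -(addn1 k) expect_iter_comp.
under eq_bigr do rewrite iterS.
by rewrite IH push_expect//; exact: law_supported.
Qed.

Lemma push_ge0 n p : (forall w, 0 <= p w) -> forall w, 0 <= push n p w.
Proof.
move=> p0 w; apply: addr_ge0; last first.
  by rewrite mulr_ge0// subr_ge0 white_prob_le1.
by case: w => // w; rewrite mulr_ge0// white_prob_ge0.
Qed.

Definition symmetric_law n (p : nat -> R) :=
  forall w, (w <= n.+1)%N -> p (n.+1 - w)%N = p w.

Lemma push_symmetric n p : supported n p -> symmetric_law n p ->
  symmetric_law n.+1 (push n p).
Proof.
move=> sp yp w wn; have n0 : n.+1%:R != 0 :> R by rewrite pnatr_eq0.
have wp1 m : (1 - white_prob n m) * p m = (m%:R / n.+1%:R) * p m.
  have [mn|mn] := leqP m n.+1; last by rewrite sp// !mulr0.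
  by congr (_ * _); rewrite white_probE//; move: (n.+1%:R : R) n0 => N n0;
    field.
rewrite /push !wp1.
have [->|w0] := posnP w; first by rewrite subn0 (sp n.+2)// /white_prob subnn
  !mul0r mulr0 addr0.
case: w w0 wn => // w _ wn; rewrite subSS.
have [->|wn'] := eqVneq w n.+1.
  by rewrite subnn (sp n.+2)// /white_prob subnn !mul0r mulr0 !addr0.
have {}wn : (w < n.+1)%N by lia.
have e : (n.+1 - w = (n.+1 - w.+1).+1)%N by lia.
rewrite (yp w (ltnW wn)) e addrC; congr (_ + _).
  by rewrite /white_prob -e.
rewrite (yp w.+1 wn); congr (_ * _).
by rewrite /white_prob subKn.
Qed.

(** Two-point form of log-concavity; it includes the absence of internal
    zeros, without which the property is not stable under [push]. *)
Definition log_concave (p : nat -> R) :=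
  forall x y, (x <= y)%N -> p x * p y.+2 <= p x.+1 * p y.+1.

(** Up to the factor [1 / (n + 1)], the new law at [w] is
    [(n + 2 - w) * p (w - 1) + w * p w]. Expanding the two products of the
    conclusion, every term is a nonnegative multiple of a two-point inequality
    for [p], except for a mixed term that is compensated thanks to the strict
    log-concavity of the weights [w] and [n + 2 - w]. *)
Lemma push_log_concave n p : supported n p -> (forall w, 0 <= p w) ->
  log_concave p -> log_concave (push n p).
Proof.
move=> sp p0 lc x y xy.
have [yn|yn] := ltnP n y.
  by rewrite (push_supported sp (w := y.+2)) ?ltnS// mulr0 mulr_ge0// push_ge0.
have n0 : 0 < n.+1%:R :> R by rewrite ltr0n.
pose prev w := if w is v.+1 then p v else 0.
have pushE w : (w <= n.+2)%N ->
    push n p w = ((n.+2%:R - w%:R) * prev w + w%:R * p w) / n.+1%:R.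
  move=> wn; rewrite mulrDl; congr (_ + _); last first.
    have [wn'|wn'] := leqP w n.+1; last by rewrite sp// !mulr0 mul0r.
    rewrite white_probE//; move: (n.+1%:R : R) n0 => N /lt0r_neq0 n0.
    by field.
  case: w wn => [|w] wn /=; first by rewrite mulr0 mul0r.
  rewrite white_probE//; move: (n.+1%:R : R) (natr1 n.+1 : _ = _ :> R) n0 => N
    <- /lt0r_neq0 n0.
  by rewrite -natr1; field.
rewrite !pushE; [|lia..].
rewrite !mulf_div ler_pM2r ?invr_gt0 ?mulr_gt0//.
rewrite /= -(natr1 x) -(natr1 y.+1) -(natr1 y).
have h1 := lc _ _ xy.
have h2 : prev x * p y.+1 <= p x * p y.
  case: x xy {h1 pushE} => [|x] xy /=; first by rewrite mul0r mulr_ge0.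
  by case: y xy {yn} => // y xy; apply: lc.
have h3 : prev x * p y.+2 <= p x * p y.+1.
  case: x xy {h1 h2 pushE} => [|x] xy /=; first by rewrite mul0r mulr_ge0.
  by apply: lc; lia.
have h4 : p x * p y.+1 <= p x.+1 * p y.
  move: xy; rewrite leq_eqVlt => /predU1P[->|]; first by rewrite mulrC.
  by case: y {yn h1 h2 h3} => // y xy; apply: lc.
have yn' : y%:R + 2 <= n.+2%:R :> R by rewrite -natrD ler_nat; lia.
have xy' : x%:R <= y%:R :> R by rewrite ler_nat.
have x0 : 0 <= x%:R :> R by [].
have pa : 0 <= prev x by rewrite /prev; case: (x).
move: (p0 x) (p0 x.+1) (p0 y) (p0 y.+1) (p0 y.+2).
move: (prev x) (p x) (p x.+1) (p y) (p y.+1) (p y.+2) pa h1 h2 h3 h4.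
move: (x%:R : R) (y%:R : R) (n.+2%:R : R) x0 xy' yn'.
move=> X Y N X0 XY YN a b c d e f a0 h1 h2 h3 h4 b0 c0 d0 e0 f0.
(* The arithmetic-geometric mean inequality absorbs the negative mixed term. *)
have h5 : 2 * (b * e) <= c * e + b * d.
  have ce0 := mulr_ge0 c0 e0; have bd0 := mulr_ge0 b0 d0.
  rewrite -ler_sqr ?nnegrE ?addr_ge0 ?mulr_ge0//.
  have : (b * e) * (b * e) <= (b * e) * (c * d) by rewrite ler_wpM2l// mulr_ge0.
  have := sqr_ge0 (c * e - b * d); nra.
rewrite -subr_ge0.
have -> : ((N - (X + 1)) * b + (X + 1) * c) * ((N - (Y + 1)) * d + (Y + 1) * e)
  - ((N - X) * a + X * b) * ((N - (Y + 1 + 1)) * e + (Y + 1 + 1) * f)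
  = X * (Y + 2) * (c * e - b * f) + (N - X) * (N - Y - 2) * (b * d - a * e)
    + (N - X) * (Y + 2) * (b * e - a * f)
    + (X + 1) * (N - Y - 1) * (c * d - b * e)
    + (Y - X + 1) * (c * e + b * d - 2 * (b * e)) by ring.
by rewrite !addr_ge0 ?mulr_ge0 ?subr_ge0//; lra.
Qed.

Lemma law_bell k n p : supported n p -> (forall w, 0 <= p w) ->
    symmetric_law n p -> log_concave p ->
  [/\ forall w, 0 <= law k n p w, symmetric_law (k + n) (law k n p)
    & log_concave (law k n p)].
Proof.
move=> sp p0 yp lp; elim: k => [//|k [q0 yq lq]].
have sq : supported (k + n) (law k n p) by apply: law_supported.
split; [exact: push_ge0|exact: push_symmetric|exact: push_log_concave].
Qed.

End UrnKernel.

(** * The mode of a symmetric log-concave law *)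

Section PairLaw.
Context {R : realFieldType}.
Implicit Types (p : nat -> R).

(** A log-concave sequence decreases at least geometrically: its tail sums
    satisfy [a 0 * T m <= a m * T 0]. Summing by parts twice turns this into a
    bound on the second moment by the total mass and the first value. *)
Lemma log_concave_moment (a : nat -> R) L : (forall i, 0 <= a i) ->
  (forall m i, a 0%N * a (m + i)%N <= a m * a i) ->
  a 0%N ^+ 2 * \sum_(0 <= i < L) i%:R ^+ 2 * a i
    <= 2 * (\sum_(0 <= i < L) a i) ^+ 3.
Proof.
move=> a0 lc; pose T m := \sum_(m <= i < L) a i.
have T0 m : 0 <= T m by apply: sumr_ge0.
have aT m : a 0%N * T m <= a m * T 0%N.
  rewrite /T -{1}(add0n m) big_addn !mulr_sumr.
  apply: (@le_trans _ _ (\sum_(0 <= i < L - m) a m * a i)).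
    by apply: ler_sum => i _; rewrite addnC; apply: lc.
  rewrite [leRHS](@big_cat_nat _ _ _ (L - m)) ?leq_subr//= lerDl.
  by apply: sumr_ge0 => i _; rewrite mulr_ge0.
have parts (f : nat -> R) : \sum_(0 <= m < L) f m * T m
    = \sum_(0 <= i < L) (\sum_(0 <= m < i.+1) f m) * a i.
  rewrite /T; elim: L {T T0 aT} => [|L IH]; first by rewrite !big_geq.
  rewrite [RHS]big_nat_recr//= -IH.
  rewrite (eq_big_nat _ _ (F2 := fun m => f m * (\sum_(m <= i < L) a i) + f m *
    a L)); last first.
    by move=> m /andP[_ mL]; rewrite big_nat_recr//= mulrDr.
  rewrite big_split /= -mulr_suml; congr (_ + _).
  by rewrite big_nat_recr//= [X in _ * X]big_geq// mulr0 addr0.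
set A := a 0%N in aT *; have A0 : 0 <= A := a0 0%N.
set M := T 0%N; have M0 : 0 <= M := T0 0%N.
pose first := \sum_(0 <= i < L) i%:R * a i.
have le1 : A * first <= M ^+ 2.
  have -> : first = \sum_(0 <= m < L) (0 < m)%N%:R * T m.
    rewrite parts; apply: eq_big_nat => i _; congr (_ * _).
    elim: i => [|i IH]; first by rewrite big_nat1.
    by rewrite big_nat_recr//= -IH natr1.
  rewrite mulr_sumr expr2 {2}/M mulr_suml; apply: ler_sum => m _.
  by case: m => [|m]; rewrite /= ?mul0r ?mulr0 ?mul1r ?mulr_ge0//.
have le2 : A * (\sum_(0 <= i < L) i%:R ^+ 2 * a i) <= 2 * (first * M).
  apply: (@le_trans _ _ (2 * (A * \sum_(0 <= m < L) m%:R * T m))).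
    rewrite mulrCA ler_wpM2l// parts mulr_sumr; apply: ler_sum => i _.
    rewrite mulrA ler_wpM2r//.
    elim: i => [|i IH]; first by rewrite big_nat1 mulr0 expr0n.
    rewrite big_nat_recr//= mulrDr -natr1.
    by apply: le_trans (lerD IH (lexx _)); rewrite -natr1; nra.
  rewrite ler_wpM2l// mulr_sumr /first mulr_suml; apply: ler_sum => m _.
  by rewrite mulrCA -mulrA ler_wpM2l.
rewrite -/(T 0%N) -/M expr2 -mulrA.
apply: le_trans (ler_wpM2l A0 le2) _.
rewrite mulrCA ler_wpM2l// mulrA exprSr.
by rewrite ler_wpM2r.
Qed.

(** Start at time [2 * i] from one of the two states next to the centre of the
    range of [w], at random: [2 * w - n - 1] is [1] or [-1] with equal chances.
    Unlike the start from the single state [w = i], where the walk is at the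
    origin, this law has the colour symmetry, so that the origin remains a mode
    at all even times. *)
Definition pair_law i w : R := 2^-1 * ((w == i) || (w == i.+1))%:R.

Local Notation plaw i k := (law k i.*2 (pair_law i)).

Lemma pair_supported i : supported i.*2 (pair_law i).
Proof.
move=> w iw; rewrite /pair_law.
by case: eqVneq => [|_]; [lia|case: eqVneq => [|_]; [lia|rewrite mulr0]].
Qed.

Lemma pair_ge0 i w : 0 <= pair_law i w.
Proof. by rewrite mulr_ge0// invr_ge0. Qed.

Lemma pair_symmetric i : symmetric_law i.*2 (pair_law i).
Proof. by move=> w wn; congr (_ * (nat_of_bool _)%:R); lia. Qed.

Lemma pair_log_concave i : log_concave (pair_law i).
Proof.
move=> x y xy; apply: (@le_trans _ _ 0); last by rewrite mulr_ge0 ?pair_ge0.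
rewrite /pair_law mulrACA -natrM mulnb.
by rewrite (_ : _ && _ = false) ?mulr0//; lia.
Qed.

Lemma pair_sum i (g : nat -> R) :
  \sum_(w < i.*2.+2) pair_law i w * g w = (g i + g i.+1) / 2.
Proof.
rewrite -(big_mkord xpredT (fun w => pair_law i w * g w)).
rewrite (@big_cat_nat _ _ _ i)//=; last by lia.
rewrite big_nat_cond big1 ?add0r; last first.
  move=> w /andP[/andP[_ wi] _]; rewrite /pair_law.
  by rewrite (_ : _ || _ = false) ?mulr0 ?mul0r//; lia.
rewrite big_ltn; last by lia.
rewrite big_ltn; last by lia.
rewrite big_nat_cond big1 ?addr0; last first.
  move=> w /andP[/andP[iw _] _]; rewrite /pair_law.
  by rewrite (_ : _ || _ = false) ?mulr0 ?mul0r//; lia.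
by rewrite /pair_law !eqxx orbT /= mulr1 -mulrDr mulrC.
Qed.

Lemma plaw_bell i k :
  [/\ supported (k + i.*2) (plaw i k), forall w, 0 <= plaw i k w,
    symmetric_law (k + i.*2) (plaw i k) & log_concave (plaw i k)].
Proof.
have [? ? ?] := law_bell k (@pair_supported i) (pair_ge0 i)
  (@pair_symmetric i) (@pair_log_concave i).
by split=> //; apply/law_supported/pair_supported.
Qed.

Lemma plaw_expect i k (g : nat -> R) :
  \sum_(w < (k + i.*2).+2) plaw i k w * g w
  = (expect_iter draw_prob count_draw k i.*2 g i
     + expect_iter draw_prob count_draw k i.*2 g i.+1) / 2.
Proof. by rewrite -law_expect ?pair_sum//; exact: pair_supported. Qed.

Lemma plaw_sum1 i k : \sum_(w < (k + i.*2).+2) plaw i k w = 1.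
Proof.
under eq_bigr do rewrite -[plaw i k _]mulr1.
rewrite (plaw_expect i k (fun=> 1)) !expect_iter_cst; first by lra.
all: exact: draw_prob_sum1.
Qed.

(** The quantity [2 * w - (n + 1)] changes sign under the colour symmetry, and
    one draw multiplies its mean by [n / (n + 1)]. *)
Definition second_moment n p : R :=
  \sum_(w < n.+2) p w * (w.*2%:R - n.+1%:R) ^+ 2.

Lemma push_second_moment n p : supported n p -> \sum_(w < n.+2) p w = 1 ->
  n.+1%:R * second_moment n.+1 (push n p)
  = n.+1%:R + (n.+1%:R - 2) * second_moment n p.
Proof.
move=> sp p1; rewrite /second_moment.
rewrite -(push_expect (fun w => (w.*2%:R - n.+2%:R) ^+ 2) sp).
transitivity (\sum_(w < n.+2)
    (n.+1%:R * p w + (n.+1%:R - 2) * (p w * (w.*2%:R - n.+1%:R) ^+ 2)));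
  last by rewrite big_split -!mulr_sumr /= p1 mulr1.
rewrite mulr_sumr; apply: eq_bigr => w _; rewrite expect_urnE white_probE;
  last by rewrite -ltnS.
have n0 : n.+1%:R != 0 :> R by rewrite pnatr_eq0.
rewrite doubleS -!(natr1 w.*2.+1) -!(natr1 w.*2) -(natr1 n.+1) -muln2 natrM.
by move: (n.+1%:R : R) n0 => N n0; field.
Qed.

(** By [push_second_moment], [n * (n - 1)] times the second moment increases
    by [n * (n + 1)] at time [n], whence a telescoping sum. *)
Lemma plaw_second_moment i k :
  let n := (k + i.*2)%N in let j := i.*2 in
  3 * (n%:R * (n%:R - 1)) * second_moment n (plaw i k)
  = (n%:R - 1) * n%:R * (n%:R + 1)
    - j%:R * (j%:R - 1) * (j%:R - 2).
Proof.
elim: k => [|k IH] /=.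
  rewrite add0n /second_moment.
  rewrite (pair_sum i (fun w => (w.*2%:R - i.*2.+1%:R) ^+ 2)).
  by rewrite doubleS -!natr1; field.
have [sp _ _ _] := plaw_bell i k.
have := push_second_moment sp (plaw_sum1 i k); rewrite addSn -!(natr1 (k +
  i.*2)).
move: IH => /=.
move: (second_moment _ _) (second_moment _ _) (k + i.*2)%:R => V' V n IH e.
have -> : 3 * ((n + 1) * (n + 1 - 1)) * V' = 3 * n * ((n + 1) * V') by ring.
by rewrite e; move: IH; lra.
Qed.

End PairLaw.

Section CentralValue.
Context {R : realFieldType}.
Implicit Types (p : nat -> R).
Local Notation plaw i k := (law k i.*2 (pair_law i)).

Lemma log_concave_inner p x t g : log_concave p ->
  p x * p (x + t + g + t)%N <= p (x + t)%N * p (x + t + g)%N.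
Proof.
move=> lc; elim: t x => [|t IH] x; first by rewrite !addn0.
apply: (@le_trans _ _ (p x.+1 * p (x + t + g + t).+1)).
  have : (x <= x + t + g + t)%N by lia.
  by move/lc; congr (_ * p _ <= _); lia.
have := IH x.+1.
by congr (p _ * p _ <= p _ * p _); lia.
Qed.

(** At an even time [2 * s] the mode is shared by [s] and [s + 1], the two
    states next to the centre [s + 1 / 2] of the range. *)
Section Bell.
Variables (s : nat) (p : nat -> R).
Hypothesis p_ge0 : forall w, 0 <= p w.
Hypothesis p_sym : symmetric_law s.*2 p.
Hypothesis p_supp : supported s.*2 p.
Hypothesis p_lc : log_concave p.
Hypothesis p_sum1 : \sum_(w < s.*2.+2) p w = 1.

Lemma bell_le_center w : p w <= p s.
Proof.
have le1 v : (v <= s)%N -> p v <= p s.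
  move=> vs; have := log_concave_inner v (s - v) 1 p_lc.
  rewrite subnKC// (_ : (s + 1 + (s - v) = s.*2.+1 - v)%N); last by lia.
  rewrite p_sym; last by lia.
  rewrite (_ : (s + 1 = s.*2.+1 - s)%N); last by lia.
  rewrite p_sym; last by lia.
  by rewrite -!expr2 ler_sqr// nnegrE.
have [|ws] := leqP w s; first exact: le1.
have [ws'|ws'] := leqP w s.*2.+1; last by rewrite p_supp.
by rewrite -p_sym// le1//; lia.
Qed.

Lemma bell_fold (g : nat -> R) :
    (forall w, (w <= s.*2.+1)%N -> g (s.*2.+1 - w)%N = g w) ->
  \sum_(w < s.*2.+2) p w * g w
  = 2 * \sum_(0 <= i < s.+1) p (s.+1 + i)%N * g (s.+1 + i)%N.
Proof.
move=> gs; rewrite -(big_mkord xpredT (fun w => p w * g w)).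
rewrite (@big_cat_nat _ _ _ s.+1)//=; last by lia.
rewrite mulr_natl mulr2n; congr (_ + _).
  rewrite big_nat_rev /= add0n; apply: eq_big_nat => i /andP[_ si].
  rewrite -p_sym; last by lia.
  rewrite -gs; last by lia.
  by congr (p _ * g _); lia.
rewrite -{1}(add0n s.+1) big_addn.
rewrite (_ : (_ - _ = s.+1)%N); last by lia.
by apply: eq_big_nat => i _; rewrite addnC.
Qed.

Lemma bell_half : \sum_(0 <= i < s.+1) p (s.+1 + i)%N = 1 / 2.
Proof.
have /= := @bell_fold (fun=> 1) (fun _ _ => erefl).
by rewrite -!mulr_suml !mulr1 p_sum1; lra.
Qed.

Lemma bell_second_moment : second_moment s.*2 p
  = 2 * \sum_(0 <= i < s.+1) p (s.+1 + i)%N * (i.*2.+1%:R) ^+ 2.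
Proof.
rewrite /second_moment (bell_fold (g := fun w => (w.*2%:R - s.*2.+1%:R) ^+ 2)).
  congr (_ * _); apply: eq_big_nat => i _; congr (_ * _ ^+ 2).
  by rewrite -natrB; [congr _%:R; lia|lia].
move=> w ws; rewrite -sqrrN; congr (_ ^+ 2).
have -> : ((s.*2.+1 - w).*2 = s.*2.+1.*2 - w.*2)%N by lia.
by rewrite natrB ?leq_double// -!muln2 !natrM; ring.
Qed.

(** The half of the law to the right of the centre is a log-concave sequence
    of mass [1 / 2] to which [log_concave_moment] applies: a large variance
    forces a small mode. *)
Lemma bell_center_upper : p s ^+ 2 * second_moment s.*2 p <= 6.
Proof.
have ps : p s.+1 = p s by rewrite -[RHS]p_sym; [congr p; lia|lia].
have lc m i : p (s.+1 + 0)%N * p (s.+1 + (m + i))%N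
    <= p (s.+1 + m)%N * p (s.+1 + i)%N.
  have [mi|/ltnW im] := leqP m i.
    have := log_concave_inner s.+1 m (i - m) p_lc.
    by congr (p _ * p _ <= p _ * p _); lia.
  have := log_concave_inner s.+1 i (m - i) p_lc.
  by rewrite [leRHS]mulrC; congr (p _ * p _ <= p _ * p _); lia.
have := @log_concave_moment _ (fun i => p (s.+1 + i)%N) s.+1
  (fun i => p_ge0 _) lc.
rewrite bell_half addn0 ps => mom.
have p1 : p s <= 1 / 2.
  rewrite -bell_half big_ltn// addn0 ps lerDl.
  by apply: sumr_ge0 => i _.
have mom2 : second_moment s.*2 p
    <= 2 * \sum_(0 <= i < s.+1) (8 * (i%:R ^+ 2 * p (s.+1 + i)%N)
         + 2 * p (s.+1 + i)%N).
  (* Here (2 * i + 1) ^ 2 <= 8 * i ^ 2 + 2 is used. *)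
  rewrite bell_second_moment ler_wpM2l//; apply: ler_sum => i _.
  rewrite mulrA -mulrDl mulrC ler_wpM2r// -(natr1 i.*2) -muln2 natrM.
  have := sqr_ge0 (2 * i%:R - 1 : R); nra.
have q0 := p_ge0 s.
apply: le_trans (ler_wpM2l (sqr_ge0 _) mom2) _.
rewrite big_split /= -!mulr_sumr bell_half; nra.
Qed.

(** Chebyshev's inequality: most of the mass lies on the [2 * r] points around
    the centre, none of which is heavier than the mode. *)
Lemma bell_center_lower r : (0 < r)%N ->
  1 / 2 - second_moment s.*2 p / (8 * r%:R ^+ 2) <= r%:R * p s.
Proof.
move=> r0; have r0' : 0 < r%:R :> R by rewrite ltr0n.
have -> : 1 / 2 - second_moment s.*2 p / (8 * r%:R ^+ 2) =
    \sum_(0 <= i < s.+1) p (s.+1 + i)%N * (1 - i.*2.+1%:R ^+ 2 / (4 * r%:R ^+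
      2)).
  rewrite -bell_half bell_second_moment.
  under [RHS]eq_bigr do rewrite mulrBr mulr1 mulrA.
  rewrite sumrB; congr (_ - _); rewrite -mulr_suml.
  by field; rewrite lt0r_neq0.
apply: (@le_trans _ _ (\sum_(0 <= i < s.+1) (i < r)%N%:R * p s)).
  apply: ler_sum => i _; case: ltnP => ir /=.
    rewrite mul1r; apply: le_trans (bell_le_center (s.+1 + i)).
    rewrite -[leRHS]mulr1; apply: ler_wpM2l; first exact: p_ge0.
    by rewrite gerBl divr_ge0 ?mulr_ge0 ?sqr_ge0.
  rewrite mul0r mulr_ge0_le0// subr_le0 ler_pdivlMr ?mulr_gt0 ?exprn_gt0//
    mul1r.
  have : r%:R <= i%:R :> R by rewrite ler_nat.
  by rewrite -(natr1 i.*2) -muln2 natrM; nra.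
rewrite -mulr_suml ler_wpM2r//.
elim: (s.+1) => [|m IH]; first by rewrite big_geq.
have [mr|rm] := leqP m.+1 r.
  apply: (@le_trans _ _ (\sum_(0 <= i < m.+1) 1)).
    by apply: ler_sum => i _; case: (_ < _)%N.
  by rewrite sumr_const_nat subn0 ler_nat.
by rewrite big_nat_recr//= ltnNge -ltnS rm addr0.
Qed.

End Bell.

(** The largest point mass at time [2 * (i + l)], started at time [2 * i]. *)
Definition center i l : R := law l.*2 i.*2 (pair_law i) (l + i)%N.

Lemma center_ge0 i l : 0 <= center i l.
Proof. by rewrite /center; case: (plaw_bell (R := R) i l.*2). Qed.

Lemma center_upper i l : (0 < l + i)%N -> center i l ^+ 2 * (l.*2.+1)%:R <= 18.
Proof.
move=> li0; have [sp p0 yp lp] := plaw_bell (R := R) i l.*2.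
have p1 := plaw_sum1 (R := R) i l.*2.
have := plaw_second_moment (R := R) i l.*2; rewrite /=.
rewrite -!doubleD in sp yp p1 *.
have := bell_center_upper p0 yp lp p1; rewrite -/(center i l).
have := sqr_ge0 (center i l).
have e : (l + i).*2%:R = l.*2%:R + i.*2%:R :> R by rewrite doubleD natrD.
have n2 : 2 <= (l + i).*2%:R :> R by rewrite ler_nat; lia.
have j2 : i.*2%:R = 0 :> R \/ 2 <= i.*2%:R :> R.
  by case: (i) => [|i']; [left|right; rewrite ler_nat; lia].
have l0 : 0 <= l.*2%:R :> R by [].
rewrite -(natr1 l.*2); move: (center i l ^+ 2) (second_moment _ _) l.*2%:R
  i.*2%:R l0 e n2 j2.
move=> q V L J L0 -> n2 j2 q0 qV vE.
have : L + 1 <= 3 * V.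
  have nn : 0 < (L + J) * (L + J - 1) by nra.
  rewrite -(ler_pM2l nn).
  have -> : (L + J) * (L + J - 1) * (3 * V) = 3 * ((L + J) * (L + J - 1)) * V
    by ring.
  rewrite vE; case: j2 => [->|J2]; first by nra.
  have h : (J - 1) * (J - 2) <= (L + J) * (L + J - 1) by nra.
  have := ler_wpM2l (ltW (lt_le_trans (ltr0Sn R 1) J2)) h; lra.
nra.
Qed.

Lemma center_lower s : (0 < s)%N -> 9 / 256 <= center 0 s ^+ 2 * s%:R.
Proof.
move=> s0; have [sp p0 yp lp] := plaw_bell (R := R) 0 s.*2.
rewrite double0 in p0 lp.
have p1 := plaw_sum1 (R := R) 0 s.*2.
have := plaw_second_moment (R := R) 0 s.*2; rewrite double0 addn0 /= in sp yp
  p1 *.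
(* The integer square root of s gives the width of the Chebyshev window. *)
have [r r0 rs] : exists2 r, (0 < r)%N & (r ^ 2 <= s < r.+1 ^ 2)%N.
  elim: s s0 {sp p0 yp lp p1} => // [[|s]] IH _; first by exists 1%N.
  have [//|r r0 /andP[rs sr]] := IH.
  have [h|h] := ltnP s.+2 (r.+1 ^ 2)%N.
    by exists r => //; rewrite h (leq_trans rs).
  by exists r.+1 => //; rewrite h (leq_ltn_trans sr)// ltn_exp2r.
have := bell_center_lower p0 yp sp lp p1 (ltn0Sn r).
have := center_ge0 0 s.
rewrite /center double0 addn0 /=.
move: (law _ _ _ _) (second_moment _ _) => q V q0.
have r1 : 1 <= r%:R :> R by rewrite ler1n.
have rs1 : r%:R ^+ 2 <= s%:R :> R by rewrite -natrX ler_nat; case/andP: rs.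
have rs2 : s%:R <= r.+1%:R ^+ 2 :> R.
  by rewrite -natrX ler_nat; case/andP: rs => _ /ltnW.
have s1 : 1 <= s%:R :> R by rewrite ler1n.
move=> h1 h2.
have Vs : V <= s%:R.
  move: h2; rewrite -muln2 natrM; move: (s%:R : R) s1 => S s1 h2.
  have : (S * 2 - 1) * (3 * V) = (S * 2 - 1) * (S * 2 + 1).
    apply: (@mulfI _ (S * 2)); first by lra.
    by move: h2; lra.
  move/mulfI => h3; have : 3 * V = S * 2 + 1 by apply: h3; lra.
  by lra.
have : V / (8 * r.+1%:R ^+ 2) <= 1 / 8.
  rewrite ler_pdivrMr; last by rewrite mulr_gt0// exprn_gt0.
  by apply: le_trans Vs _; lra.
move: h1; rewrite -(natr1 r) => h1 hV.
have : 3 / 16 <= r%:R * q by nra.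
nra.
Qed.

End CentralValue.

(** * Return probabilities of one coordinate *)

Section Returns.
Context {R : realFieldType}.
Local Notation Kiter := (expect_iter (@draw_prob R) count_draw).

(** The coordinate of the walk is [w - (n - w)]. *)
Definition at_origin (n w : nat) : bool := w.*2 == n.

Lemma center_expect i l :
  center i l = (Kiter l.*2 i.*2 (fun w => (at_origin (l.*2 + i.*2) w)%:R) i
   + Kiter l.*2 i.*2 (fun w => (at_origin (l.*2 + i.*2) w)%:R) i.+1) / 2.
Proof.
rewrite -plaw_expect -(big_mkord xpredT
  (fun w => law _ _ (pair_law i) w * (at_origin (l.*2 + i.*2) w)%:R)).
rewrite (big_cat_nat (n := (l + i)%N))//=; last by lia.
rewrite big_nat_cond big1 ?add0r; last first.
  move=> w /andP[/andP[_ wi] _]; rewrite /at_origin.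
  by rewrite (_ : _ == _ = false) ?mulr0//; lia.
rewrite big_ltn; last by lia.
rewrite big_nat_cond big1 ?addr0; last first.
  move=> w /andP[/andP[iw _] _]; rewrite /at_origin.
  by rewrite (_ : _ == _ = false) ?mulr0//; lia.
by rewrite /at_origin doubleD eqxx mulr1.
Qed.

Let Kiter_ge0 k n (b : nat -> bool) w : 0 <= Kiter k n (fun t => (b t)%:R) w.
Proof. by apply: expect_iter_ge0 => [? ? ?|t]; rewrite ?draw_prob_ge0. Qed.

(** The single state [i] has probability one half under the pair start. *)
Lemma return_le_center i l :
  Kiter l.*2 i.*2 (fun w => (at_origin (l.*2 + i.*2) w)%:R) i <= 2 * center i l.
Proof.
have := Kiter_ge0 l.*2 i.*2 (at_origin (l.*2 + i.*2)) i.+1.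
by rewrite center_expect; lra.
Qed.

(** The first draw is white with certainty, and from the impossible state
    [w = 1] at time [0] it would be blue with certainty: both states of the
    pair start lead to [w = 1] at time [1], so that the pair start at time [0]
    describes the true urn. *)
Lemma return_center s : (0 < s)%N ->
  Kiter s.*2 0 (fun w => (at_origin s.*2 w)%:R) 0%N = center 0 s.
Proof.
case: s => // s _; rewrite center_expect double0 addn0 doubleS /=.
rewrite !expect_urnE /white_prob subn0 subnn divff ?oner_eq0//.
by rewrite mul0r !mul1r subrr !mul0r subr0 mul1r addr0 add0r; lra.
Qed.

Lemma return_odd k n w : odd k -> ~~ odd n ->
  Kiter k n (fun w => (at_origin (k + n) w)%:R) w = 0.
Proof.
move=> ok en; rewrite -[RHS](expect_iter_cst count_draw (@draw_prob_sum1 R) k n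
  0 w).
apply: eq_expect_iter => t; rewrite /at_origin.
by case: eqVneq => // e; move: ok en; lia.
Qed.

End Returns.

(** * Two independent coordinates *)

Section Plane.
Context {R : realFieldType}.
Implicit Types (g : nat * nat -> R) (s : nat * nat).

Local Notation K := (expect (@draw_prob R) count_draw).
Local Notation Kiter := (expect_iter (@draw_prob R) count_draw).

Definition draw_prob2 (n : nat) s (c : bool * bool) : R :=
  draw_prob n s.1 c.1 * draw_prob n s.2 c.2.

Definition count_draw2 s (c : bool * bool) :=
  (count_draw s.1 c.1, count_draw s.2 c.2).

Definition at_origin2 (n : nat) s := at_origin n s.1 && at_origin n s.2.

Local Notation K2 := (expect draw_prob2 count_draw2).
Local Notation K2iter := (expect_iter draw_prob2 count_draw2).

Lemma draw_prob2_ge0 n s c : 0 <= draw_prob2 n s c.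
Proof. by rewrite mulr_ge0 ?draw_prob_ge0. Qed.

Lemma expect2E n g s :
  K2 n g s = K n (fun x => K n (fun y => g (x, y)) s.2) s.1.
Proof.
rewrite /expect -(pair_bigA _ (fun a b => draw_prob2 n s (a, b)
  * g (count_draw2 s (a, b))))/=.
apply: eq_bigr => a _; rewrite mulr_sumr; apply: eq_bigr => b _.
by rewrite mulrA.
Qed.

Lemma draw_prob2_sum1 n s : \sum_c draw_prob2 n s c = 1.
Proof.
have := expect2E n (fun=> 1) s.
rewrite /expect; under eq_bigr do rewrite mulr1.
move=> ->; under eq_bigr => a _.
  under eq_bigr do rewrite mulr1.
  rewrite draw_prob_sum1 mulr1; over.
exact: draw_prob_sum1.
Qed.

Lemma expect_iter2_prod k n (g h : nat -> R) s :
  K2iter k n (fun t => g t.1 * h t.2) s = Kiter k n g s.1 * Kiter k n h s.2.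
Proof.
elim: k n s => [|k IH] n s //=.
rewrite (eq_expect _ _ _ _ (IH n.+1)) expect2E /= -expectMr.
apply: eq_expect => x; rewrite mulrC -expectMr.
by apply: eq_expect => y; rewrite mulrC.
Qed.

Lemma expect_iter2_swap k n g s :
  K2iter k n g s = K2iter k n (fun t => g (t.2, t.1)) (s.2, s.1).
Proof.
elim: k n s => [|k IH] n s /=; first by case: s.
rewrite (eq_expect _ _ _ _ (IH n.+1)) !expect2E /= !expect_urnE /=; ring.
Qed.

Lemma expect2_contract n (x : R) g : 0 <= x ->
  (forall u v, (u <= n.+1)%N -> `|g (u.+1, v) - g (u, v)| <= x) ->
  forall u v, (u <= n)%N ->
    `|K2 n g (u.+1, v) - K2 n g (u, v)| <= n%:R / n.+1%:R * x.
Proof.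
move=> x0 gx u v un; rewrite !expect2E /=.
apply: (@expect_contract _ n x (fun u => K n (fun y => g (u, y)) v)) => // w wn.
rewrite !expect_urnE opprD addrACA -!mulrBr.
have q0 := white_prob_ge0 (R := R) n v; have q1 := white_prob_le1 (R := R) n v.
rewrite (le_trans (ler_normD _ _))// (normrM (white_prob _ _)) (normrM (1 - _))
  (ger0_norm q0).
rewrite (@ger0_norm _ (1 - _)) ?subr_ge0//.
have h1 := ler_wpM2l q0 (gx w v.+1 wn).
have q1' : 0 <= 1 - white_prob n v :> R by rewrite subr_ge0.
have h2 := ler_wpM2l q1' (gx w v wn).
by apply: le_trans (lerD h1 h2) _; rewrite -mulrDl addrC subrK mul1r.
Qed.

(** By iteration of the one-step contraction, two neighbouring starting points
    at time [n] are told apart at time [k + n] with probability at most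
    [n / (k + n)]. *)
Lemma expect_iter2_contract k n g : (forall s, 0 <= g s <= 1) ->
  forall u v, (u <= n)%N ->
  (k + n)%:R * `|K2iter k n g (u.+1, v) - K2iter k n g (u, v)| <= n%:R.
Proof.
move=> g01; elim: k n => [|k IH] n u v un /=.
  rewrite -[leRHS]mulr1 ler_wpM2l// ler_norml.
  have /andP[? ?] := g01 (u.+1, v); have /andP[? ?] := g01 (u, v).
  by apply/andP; split; lra.
have m0 : 0 < (k.+1 + n)%:R :> R by rewrite ltr0n.
have n0 : 0 < n.+1%:R :> R by rewrite ltr0n.
rewrite mulrC -ler_pdivlMr//.
apply: le_trans (expect2_contract (x := n.+1%:R / (k.+1 + n)%:R) _ _ v un) _.
- by rewrite divr_ge0.
- move=> u' v' un'; rewrite ler_pdivlMr// mulrC addSnnS; exact: IH.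
- by rewrite mulrA divfK// lt0r_neq0.
Qed.

(** The bound does not depend on [k]: the walk forgets its state at time [n]. *)
Lemma expect_iter2_osc k n g : (forall s, 0 <= g s <= 1) ->
  forall s s', (s.1 <= n)%N -> (s.2 <= n)%N -> (s'.1 <= n)%N -> (s'.2 <= n)%N ->
  (k + n)%:R * (K2iter k n g s - K2iter k n g s') <= 4 * n%:R ^+ 2.
Proof.
move=> g01.
have step1 h u v : (forall s, 0 <= h s <= 1) -> (u <= n)%N ->
    (k + n)%:R * `|K2iter k n h (u, v) - K2iter k n h (0%N, v)| <= u%:R * n%:R.
  move=> h01; elim: u => [|u IH] un; first by rewrite subrr normr0 mulr0 mul0r.
  rewrite -(natr1 u) mulrDl mul1r.
  apply: le_trans (lerD (IH (ltnW un)) (expect_iter2_contract k h01 v (ltnW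
    un))).
  by rewrite -mulrDr ler_wpM2l// [leRHS]addrC ler_distD.
have all u v : (u <= n)%N -> (v <= n)%N ->
    (k + n)%:R * `|K2iter k n g (u, v) - K2iter k n g (0%N, 0%N)| <= 2 * n%:R
      ^+ 2.
  move=> un vn.
  have h1 := step1 g u v g01 un.
  have h2 := step1 (fun t => g (t.2, t.1)) v 0%N (fun s => g01 _) vn.
  move: h2; rewrite -(expect_iter2_swap _ _ _ (0%N, v)).
  rewrite -(expect_iter2_swap _ _ _ (0%N, 0%N)) => h2.
  have nu : u%:R * n%:R <= n%:R ^+ 2 :> R by rewrite expr2 ler_wpM2r// ler_nat.
  have nv : v%:R * n%:R <= n%:R ^+ 2 :> R by rewrite expr2 ler_wpM2r// ler_nat.
  apply: (@le_trans _ _ (u%:R * n%:R + v%:R * n%:R)); last by lra.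
  apply: le_trans (lerD h1 h2); rewrite -mulrDr ler_wpM2l//.
  exact: ler_distD.
move=> [u v] [u' v'] /= un vn un' vn'.
have h1 := all u v un vn; have h2 := all u' v' un' vn'.
have -> : 4 * n%:R ^+ 2 = 2 * n%:R ^+ 2 + 2 * n%:R ^+ 2 :> R by ring.
apply: le_trans (lerD h1 h2); rewrite -mulrDr ler_wpM2l//.
rewrite [X in _ <= _ + X]distrC; apply: le_trans (ler_norm _) _.
exact: ler_distD.
Qed.

End Plane.

(** * Uniform hitting probabilities in the plane *)

Section Hitting.
Local Open Scope classical_set_scope.
Context {R : realType}.
Implicit Types (s : nat * nat).
Local Notation H := (series (@harmonic R)).
Local Notation avoid1 := (avoid (@draw_prob R) count_draw at_origin).
Local Notation K2iter := (expect_iter (@draw_prob2 R) count_draw2).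
Local Notation avoid2 := (avoid (@draw_prob2 R) count_draw2 at_origin2).
Local Notation visits2 := (visits (@draw_prob2 R) count_draw2 at_origin2).
Local Notation Kiter := (expect_iter (@draw_prob R) count_draw).

Lemma harmonic_unbounded (B : R) : exists L, B <= H L.
Proof.
apply: contrapT => nB; apply: (@dvg_harmonic R).
apply: nondecreasing_is_cvgn.
  by apply: nondecreasing_series => i _ _; exact: harmonic_ge0.
exists B => _ [L _ <-].
by have [//|BL] := leP (H L) B; exfalso; apply: nB; exists L; exact: ltW.
Qed.

Lemma harmonic_sum_ge0 L : 0 <= H L.
Proof. by rewrite seriesEnat /=; apply: sumr_ge0 => i _;
  exact: harmonic_ge0. Qed.

Lemma sum_pairs (F : nat -> R) L :
  \sum_(i < L.*2) F i = \sum_(0 <= l < L) (F l.*2 + F l.*2.+1).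
Proof.
elim: L => [|L IH]; first by rewrite big_ord0 big_geq.
by rewrite big_nat_recr//= doubleS 2!big_ord_recr /= IH addrA.
Qed.

Lemma at_origin2_expect k n m u v :
  K2iter k n (fun t => (at_origin2 m t)%:R) (u, v)
  = Kiter k n (fun w => (at_origin m w)%:R) u
    * Kiter k n (fun w => (at_origin m w)%:R) v.
Proof.
rewrite -(expect_iter2_prod k n _ _ (u, v)); apply: eq_expect_iter => t.
by rewrite -natrM mulnb.
Qed.

Let K2iter_ge0 k n (b : nat * nat -> bool) s :
  0 <= K2iter k n (fun t => (b t)%:R) s.
Proof. by apply: expect_iter_ge0 => [? ? ?|t]; rewrite ?draw_prob2_ge0. Qed.

Let visits2E := visitsE count_draw2 at_origin2 (@draw_prob2_sum1 R).

(** From the origin at time [2 * i], the chance of being back [2 * (l + 1)]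
    steps later is the square of a quantity of order at most
    [1 / sqrt (l + 1)], uniformly in [i]. *)
Lemma visits_after_origin i k L : (0 < i)%N -> (k <= L.*2)%N ->
  visits2 k i.*2 (i, i) <= 36 * H L.
Proof.
move=> i0 kL; rewrite visits2E.
pose F l := K2iter l.+1 i.*2 (fun t => (at_origin2 (i.*2 + l.+1) t)%:R) (i, i).
apply: (@le_trans _ _ (\sum_(l < L.*2) F l)).
  rewrite -!(big_mkord xpredT F) [leRHS](big_cat_nat (n := k))//=.
  by rewrite lerDl; apply: sumr_ge0 => l _; exact: K2iter_ge0.
rewrite sum_pairs seriesEnat mulr_sumr /=; apply: ler_sum => l _.
rewrite {1}/F at_origin2_expect addnC return_odd/= ?odd_double// mul0r add0r.
rewrite /F at_origin2_expect -doubleS addnC.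
have := center_upper (R := R) (i := i) (l := l.+1).
rewrite addn_gt0 i0 => /(_ isT).
have := return_le_center (R := R) i l.+1.
have : 0 <= Kiter l.+1.*2 i.*2 (fun w => (at_origin (l.+1.*2 + i.*2) w)%:R) i
  :> R.
  by apply: expect_iter_ge0 => [? ? ?|t]; rewrite ?draw_prob_ge0.
move: (Kiter _ _ _ _) (center i l.+1) => x c x0 xc c18.
have l0 : 0 < l.+1%:R :> R by rewrite ltr0n.
rewrite -[36 * _]/(36 / _) ler_pdivlMr//.
move: c18; rewrite -(natr1 l.+1.*2) -muln2 natrM.
move: l0; move: (l.+1%:R : R) => N N0 c18.
have xx : x * x <= 4 * c ^+ 2 by nra.
have := ler_wpM2r (ltW N0) xx; have := sqr_ge0 c; lra.
Qed.

Lemma visits_from_start a L :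
  9 / 256 * (H (a + L) - H a) <=
  K2iter a.*2 0 (visits2 L.*2 a.*2) (0, 0)%N.
Proof.
pose F l := K2iter (a.*2 + l.+1) 0 (fun t => (at_origin2 (a.*2 + l.+1) t)%:R)
  (0, 0)%N.
have -> : K2iter a.*2 0 (visits2 L.*2 a.*2) (0, 0)%N = \sum_(l < L.*2) F l.
  rewrite (eq_expect_iter _ _ _ _ _ (visits2E L.*2 a.*2)).
  rewrite expect_iter_sum; last exact: draw_prob2_sum1.
  by apply: eq_bigr => l _; rewrite /F expect_iter_comp addn0.
have -> : H (a + L) - H a = \sum_(0 <= l < L) (l + a).+1%:R^-1.
  rewrite !seriesEnat /= (big_cat_nat (n := a)) ?leq_addr//=.
  by rewrite [X in X - _]addrC addrK -{1}(add0n a) big_addn addKn.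
rewrite sum_pairs mulr_sumr.
apply: ler_sum => l _; apply: (@le_trans _ _ (F l.*2.+1)); last first.
  by rewrite lerDr; exact: K2iter_ge0.
rewrite /F at_origin2_expect -doubleS -doubleD return_center;
  last by rewrite addnS.
have := center_lower (R := R) (s := a + l.+1).
rewrite addnS addnC => /(_ isT).
by rewrite expr2 -ler_pdivrMr ?ltr0n.
Qed.

(** The constant [9 / 256] of [center_lower], divided by [2 * 37] in
    [avoid2_start] and by [2] again to absorb the memory of the state. *)
Definition hit_bound : R := 9 / 256 / 148.

Definition valid2 (n : nat) s : Prop := (s.1 <= n)%N /\ (s.2 <= n)%N.

Lemma valid2_next n s c : valid2 n s -> valid2 n.+1 (count_draw2 s c).
Proof.
have draw m (b : bool) : (m <= n)%N -> (m + b <= n.+1)%N.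
  by move=> mn; rewrite -addn1 leq_add//; case: b.
by move=> [s1 s2]; split; apply: draw.
Qed.

(** From the true start, the expected number of visits between times [2 * a]
    and [2 * (a + L)] and the number expected after a visit are both of the
    order of the harmonic sum [H L]: their ratio bounds the probability of a
    visit from below. *)
Lemma avoid2_start a L : 2 * H a + 1 <= H L ->
  K2iter a.*2 0 (avoid2 L.*2 a.*2) (0, 0)%N <= 1 - 2 * hit_bound.
Proof.
move=> HaL; set A0 := K2iter _ _ _ _.
have Ha := harmonic_sum_ge0 a.
pose G := 1 + 36 * H L; have G0 : 0 <= G by rewrite /G; lra.
have le_hit t : visits2 L.*2 a.*2 t <= (1 - avoid2 L.*2 a.*2 t) * G.
  apply: visits_le_hit => //; [exact: draw_prob2_ge0|exact: draw_prob2_sum1|].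
  move=> i [u v] iL /andP[/eqP/= uE /eqP vE]; rewrite lerD2l.
  rewrite (_ : v = u); last by apply: double_inj; rewrite uE vE.
  have u0 : (0 < u)%N by rewrite -double_gt0 uE; lia.
  by rewrite -uE; apply: visits_after_origin u0 (ltnW iL).
have h1 : K2iter a.*2 0 (visits2 L.*2 a.*2) (0, 0)%N <= (1 - A0) * G.
  have -> : (1 - A0) * G
      = K2iter a.*2 0 (fun t => (1 - avoid2 L.*2 a.*2 t) * G) (0, 0)%N.
    rewrite expect_iterMr; congr (_ * _); apply/eqP; rewrite subr_eq.
    rewrite -expect_iterD.
    rewrite -[X in X == _](expect_iter_cst count_draw2 (@draw_prob2_sum1 R)
      a.*2 0 1 (0, 0)%N).
    by apply/eqP/eq_expect_iter => t; rewrite subrK.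
  by apply: (expect_iter_le (@draw_prob2_ge0 R) (valid := fun _ _ => True)).
have h2 := le_trans (visits_from_start a L) h1.
have HL : H L <= H (a + L).
  by rewrite (nondecreasing_series (P := xpredT))// ?leq_addl// => i _ _;
    exact: harmonic_ge0.
have A01 : 0 <= 1 - A0.
  rewrite subr_ge0 -(expect_iter_cst count_draw2 (@draw_prob2_sum1 R)
      a.*2 0 1 (0, 0)%N).
  apply: (expect_iter_le (@draw_prob2_ge0 R) (valid := fun _ _ => True)) => //
    t _.
  exact/avoid_le1/draw_prob2_sum1/draw_prob2_ge0.
have : 2 * hit_bound <= 1 - A0; last by lra.
rewrite -(ler_pM2r (x := 37 * H L)); last by lra.
have : (1 - A0) * G <= (1 - A0) * (37 * H L) by rewrite ler_wpM2l// /G; lra.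
by rewrite /hit_bound; lra.
Qed.

(** The bound of [avoid2_start] averages over the states at time [n], and the
    walk forgets that state before time [2 * a]: so it holds from every
    state. *)
Lemma avoid2_uniform n :
  exists k, forall s, valid2 n s -> avoid2 k n s <= 1 - hit_bound.
Proof.
have d0 : 0 < hit_bound by rewrite /hit_bound; lra.
have start := @avoid2_start.
(* Only the sign of the constant matters from here on. *)
move: hit_bound d0 start => d d0 start.
pose b := Num.bound (4 * n%:R ^+ 2 / d : R).
have hb : 4 * n%:R ^+ 2 < b%:R * d.
  rewrite -ltr_pdivrMr//; apply: archi_boundP.
  by rewrite divr_ge0 ?mulr_ge0 ?sqr_ge0// ltW.
(* Time 2 * a is so late that the oscillation 4 * n ^ 2 / (2 * a) is below d. *)
move: b hb => b hb; pose a := (n + b)%N.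
have na : (n <= a.*2)%N by rewrite /a; lia.
have ba : b%:R <= a.*2%:R :> R by rewrite ler_nat /a; lia.
have [L HL] := harmonic_unbounded (2 * H a + 1).
exists (a.*2 - n + L.*2)%N => s [s1 s2].
have := avoid_skip count_draw2 at_origin2 (@draw_prob2_ge0 R) (a.*2 - n) L.*2 n
  s.
rewrite subnK// => /le_trans; apply.
pose Phi := K2iter (a.*2 - n) n (avoid2 L.*2 a.*2); rewrite -/(Phi s).
have osc t : valid2 n t -> Phi s - d <= Phi t.
  move=> [t1 t2]; rewrite lerBlDr -lerBlDl.
  have g01 t' : 0 <= avoid2 L.*2 a.*2 t' <= 1.
    rewrite avoid_ge0 ?avoid_le1//; move=> *.
    - exact: draw_prob2_ge0.
    - exact: draw_prob2_sum1.
    - exact: draw_prob2_ge0.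
  have := expect_iter2_osc (a.*2 - n) g01 s1 s2 t1 t2;
    rewrite -/(Phi s) -/(Phi t).
  rewrite subnK// => h.
  have a0 : 0 < a.*2%:R :> R.
    apply: lt_le_trans ba; rewrite -(pmulr_lgt0 _ d0).
    by apply: le_lt_trans hb; rewrite mulr_ge0 ?sqr_ge0.
  rewrite -(ler_pM2l a0) (le_trans h)// (le_trans (ltW hb))//.
  by rewrite ler_wpM2r// ltW.
have := start a L HL.
have -> : K2iter a.*2 0 (avoid2 L.*2 a.*2) (0, 0)%N = K2iter n 0 Phi (0, 0)%N.
  by rewrite -{1}(subnKC na) expect_iter_comp addn0.
have : Phi s - d <= K2iter n 0 Phi (0, 0)%N; last by lra.
rewrite -[leLHS](expect_iter_cst count_draw2 (@draw_prob2_sum1 R) n 0 _ (0,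
  0)%N).
apply: (expect_iter_le (@draw_prob2_ge0 R) valid2_next) => // t.
by rewrite addn0; apply: osc.
Qed.

(** A plane walk at the origin has its first coordinate at the origin; this
    spares a separate study of dimension one. *)
Lemma avoid1_le_avoid2 k n u v : avoid1 k n u <= avoid2 k n (u, v).
Proof.
elim: k n u v => [|k IH] n u v //=; rewrite expect2E /=.
apply: expect_le => [? ? ?|a]; first exact: draw_prob_ge0.
case: ifP => [ua|ua].
  apply: sumr_ge0 => b _; rewrite mulr_ge0 ?draw_prob_ge0//.
  case: ifP => // _; apply: avoid_ge0 => *; exact: draw_prob2_ge0.
rewrite -[leLHS](expect_cst count_draw (@draw_prob_sum1 R) n _ v).
apply: expect_le => [? ? ?|b]; first exact: draw_prob_ge0.
by rewrite /at_origin2 /= ua; exact: IH.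
Qed.

Lemma avoid2_vanish n s (e : R) : valid2 n s -> 0 < e ->
  exists k, avoid2 k n s < e.
Proof.
move=> ns e0; have d1 : 0 <= 1 - hit_bound by rewrite /hit_bound; lra.
have [r hr] : exists r, (1 - hit_bound) ^+ r < e.
  have /cvgrPdist_lt/(_ e e0)[r _ hr] : (1 - hit_bound) ^+ i @[i -->
    \oo]%classic --> (0 : R).
    by apply: cvg_expr; rewrite ger0_norm// /hit_bound; lra.
  by exists r; have := hr r (leqnn r); rewrite /= sub0r normrN ger0_norm//
    exprn_ge0.
have [k hk] := avoid_geometric (@draw_prob2_ge0 R) valid2_next d1
  avoid2_uniform r n.
by exists k; apply: le_lt_trans (hk s ns) hr.
Qed.

Lemma avoid1_vanish n u (e : R) : (u <= n)%N -> 0 < e ->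
  exists k, avoid1 k n u < e.
Proof.
move=> un e0; have [k hk] := @avoid2_vanish n (u, u) e (conj un un) e0.
by exists k; apply: le_lt_trans hk; exact: avoid1_le_avoid2.
Qed.

Lemma return_upper m : (0 < m)%N ->
  Kiter m.*2 0 (fun w => (at_origin m.*2 w)%:R) 0%N ^+ 2 * m.*2.+1%:R <= 18.
Proof.
by move=> m0; have := center_upper (R := R) (i := 0) (l := m);
  rewrite addn0 return_center//; apply.
Qed.

End Hitting.

(** * From transition kernels to almost sure statements *)

Section Histories.
Local Open Scope classical_set_scope.
Context {disp : measure_display} {T : measurableType disp} {E : finType}.
Variable Z : nat -> T -> E.

Definition cylinder (h : seq E) : set T :=
  [set w | mkseq (Z ^~ w) (size h) = h].

Lemma cylinder_rcons h c :
  cylinder (rcons h c) = cylinder h `&` [set w | Z (size h) w = c].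
Proof.
apply/seteqP; split=> w; rewrite /cylinder /= size_rcons mkseqS.
  by move/rcons_inj => [].
by move=> [-> ->].
Qed.

Lemma cylinder_mkseq n w : cylinder (mkseq (Z ^~ w) n) w.
Proof. by rewrite /cylinder /= size_mkseq. Qed.

Hypothesis mZ : forall n c, measurable [set w | Z n w = c].

Lemma cylinder_measurable h : measurable (cylinder h).
Proof.
elim/last_ind: h => [|h c IH]; last by rewrite cylinder_rcons;
  exact: measurableI.
by rewrite (_ : cylinder _ = setT)//; apply/seteqP.
Qed.

Lemma history_measurable n (Q : seq E -> bool) :
  measurable [set w | Q (mkseq (Z ^~ w) n)].
Proof.
rewrite (_ : [set _ | _] = \bigcup_h
    (if Q h && (size h == n) then cylinder h else set0)).
  apply: countable_bigcupT_measurable; first exact: countableP.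
  by move=> h; case: ifP => _ //; exact: cylinder_measurable.
apply/seteqP; split=> w /=.
  by move=> Qw; exists (mkseq (Z ^~ w) n) => //; rewrite Qw size_mkseq eqxx/=;
    exact: cylinder_mkseq.
by move=> [h _]; case: ifP => // /andP[Qh /eqP <-]; rewrite /cylinder/= => ->.
Qed.

End Histories.

Section DrivenChain.
Local Open Scope classical_set_scope.
Context {R : realType} {disp : measure_display} {T : measurableType disp}.
Context {E : finType} {S : Type}.
Variables (P : probability T R) (Z : nat -> T -> E).
Variables (kappa : nat -> S -> E -> R) (next : S -> E -> S) (start : S).
Variable target : nat -> S -> bool.
Hypothesis mZ : forall n c, measurable [set w | Z n w = c].
Hypothesis cylinder_law : forall h c, P (cylinder Z (rcons h c))
  = (P (cylinder Z h) * (kappa (size h) (foldl next start h) c)%:E)%E.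

Definition state n w := foldl next start (mkseq (Z ^~ w) n).

Lemma state_rcons h c w : cylinder Z (rcons h c) w ->
  state (size h).+1 w = next (foldl next start h) c.
Proof. by rewrite /cylinder /= /state size_rcons => ->;
  rewrite foldl_rcons. Qed.

Lemma cylinder_split h B : measurable B ->
  P (cylinder Z h `&` B) = (\sum_c P (cylinder Z (rcons h c) `&` B))%E.
Proof.
move=> mB; rewrite (_ : _ `&` _ = \bigcup_(c in [set` index_enum E])
    (cylinder Z (rcons h c) `&` B)).
  rewrite measure_fin_bigcup -?fsbig_seq ?index_enum_uniq//.
  - move=> c c' _ _ [w [[+ _] [+ _]]]; rewrite !cylinder_rcons.
    by move=> [_ <-] [_ <-].
  - by move=> c _; apply: measurableI => //; exact: cylinder_measurable.
apply/seteqP; split=> w; last by move=> [c _ [+ Bw]];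
  rewrite cylinder_rcons => -[].
move=> [hw Bw]; exists (Z (size h) w); first by rewrite /= mem_index_enum.
by split=> //; rewrite cylinder_rcons.
Qed.

Lemma state_measurable n (A : S -> bool) : measurable [set w | A (state n w)].
Proof. exact: (history_measurable mZ n (fun h => A (foldl next start h))). Qed.

Let fin_cyl h : P (cylinder Z h) = (fine (P (cylinder Z h)))%:E.
Proof. by rewrite fineK// fin_num_measure//; exact: cylinder_measurable. Qed.

Let cylinder_step h (g : S -> R) :
  (\sum_c P (cylinder Z (rcons h c)) * (g (next (foldl next start h) c))%:E)%E
  = (P (cylinder Z h) *
      (expect kappa next (size h) g (foldl next start h))%:E)%E.
Proof.
rewrite (fin_cyl h) -EFinM mulr_sumr -sumEFin; apply: eq_bigr => c _.
by rewrite cylinder_law fin_cyl -!EFinM mulrA.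
Qed.

Lemma cylinder_expect k h (A : S -> bool) :
  P (cylinder Z h `&` [set w | A (state (size h + k) w)])
  = (P (cylinder Z h) *
    (expect_iter kappa next k (size h) (fun s => (A s)%:R) (foldl next start
      h))%:E)%E.
Proof.
elim: k h => [|k IH] h /=.
  rewrite addn0; case: (boolP (A (foldl next start h))) => Ah.
    rewrite mule1; congr (P _); apply/seteqP; split=> w; first by case.
    by move=> hw; split=> //=; rewrite /state hw.
  rewrite mule0; rewrite (_ : _ `&` _ = set0) ?measure0//.
  by apply/seteqP; split=> w //= [hw]; rewrite /state hw (negbTE Ah).
rewrite cylinder_split; last exact: state_measurable.
rewrite -cylinder_step; apply: eq_bigr => c _.
by have := IH (rcons h c); rewrite size_rcons foldl_rcons addSnnS.
Qed.

Lemma state_law n (A : S -> bool) :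
  P [set w | A (state n w)] = (expect_iter kappa next n 0 (fun s => (A s)%:R)
    start)%:E.
Proof.
have := cylinder_expect n [::] A; rewrite add0n/=.
have -> : cylinder Z [::] = setT by apply/seteqP.
by rewrite setTI probability_setT mul1e.
Qed.

Definition avoiding n k : set T :=
  [set w | forall i, (n < i <= n + k)%N -> ~~ target i (state i w)].

Lemma avoiding_measurable n k : measurable (avoiding n k).
Proof.
rewrite (_ : avoiding n k = \bigcap_i
   (if (n < i <= n + k)%N then [set w | ~~ target i (state i w)] else setT)).
  apply: bigcapT_measurable => i; case: ifP => // _.
  exact: (state_measurable i (fun s => ~~ target i s)).
apply/seteqP; split=> w /=; first by move=> H i _; case: ifP => //; exact: H.
by move=> H i ik; have := H i I; rewrite ik.
Qed.

Lemma cylinder_avoid k h :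
  P (cylinder Z h `&` avoiding (size h) k)
  = (P (cylinder Z h) *
    (avoid kappa next target k (size h) (foldl next start h))%:E)%E.
Proof.
elim: k h => [|k IH] h /=.
  rewrite mule1; congr (P _); apply/seteqP; split=> w; first by case.
  by move=> hw; split=> // i; lia.
rewrite cylinder_split; last exact: avoiding_measurable.
rewrite -cylinder_step; apply: eq_bigr => c _.
have := IH (rcons h c); rewrite size_rcons foldl_rcons.
case: ifP => [hit _|nohit <-].
  rewrite mule0 (_ : _ `&` _ = set0) ?measure0//.
  apply/seteqP; split=> w //= [hw] /(_ (size h).+1).
  by rewrite (state_rcons hw) hit => /(_ _)/negP; apply => //; lia.
congr (P _); apply/seteqP; split=> w [hw H]; split=> // i ik.
  by apply: H; lia.
have [->|ne] := eqVneq i (size h).+1; first by rewrite (state_rcons hw) nohit.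
by apply: H; lia.
Qed.

(** Missing the target forever after a given history has probability at most
    [avoid k] for every [k], hence zero; there are countably many
    histories. *)
Lemma visits_io (valid : nat -> S -> Prop) :
    (forall n s c, valid n s -> valid n.+1 (next s c)) -> valid 0%N start ->
    (forall n s (e : R), valid n s -> 0 < e ->
      exists k, avoid kappa next target k n s < e) ->
  P (lim_sup_set (fun n => [set w | target n (state n w)])) = 1%E.
Proof.
move=> vnext v0 van.
have mlim : measurable (lim_sup_set (fun n => [set w | target n (state n w)])).
  apply: bigcapT_measurable => n; apply: bigcup_measurable => j _.
  exact: state_measurable.
have valid_run h : valid (size h) (foldl next start h).
  by elim/last_ind: h => // h c IH; rewrite size_rcons foldl_rcons;
    apply: vnext.
pose never n := \bigcap_k avoiding n k.
have mnever n : measurable (never n).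
  by apply: bigcapT_measurable => k; exact: avoiding_measurable.
have null h : P.-negligible (cylinder Z h `&` never (size h)).
  have mh := measurableI _ _ (cylinder_measurable mZ h) (mnever (size h)).
  apply/(negligibleP _ mh); apply/eqP; rewrite eq_le measure_ge0 andbT.
  apply/lee_addgt0Pr => e e0; rewrite add0e.
  have [k hk] := van _ _ e (valid_run h) e0.
  apply: (@le_trans _ _ (P (cylinder Z h `&` avoiding (size h) k))).
    rewrite le_measure ?inE//.
      by apply: measurableI; [exact: cylinder_measurable|exact:
        avoiding_measurable].
    by move=> w [hw H]; split=> //; exact: H.
  rewrite cylinder_avoid fin_cyl -EFinM lee_fin.
  have p0 : 0 <= fine (P (cylinder Z h)) by rewrite fine_ge0.
  have p1 : fine (P (cylinder Z h)) <= 1.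
    by rewrite -lee_fin -fin_cyl probability_le1//; exact: cylinder_measurable.
  have := ler_wpM2l p0 (ltW hk); have := ler_wpM2r (ltW e0) p1; lra.
have nullU : P.-negligible (~` lim_sup_set (fun n => [set w | target n (state n
  w)])).
  pose h i : seq E := odflt [::] (unpickle i).
  apply: (negligibleS
      (A := \bigcup_i (cylinder Z (h i) `&` never (size (h i))))); last first.
    exact: negligible_bigcup.
  move=> w /existsNP[n /not_implyP[_ nw]].
  exists (pickle (mkseq (Z ^~ w) n)) => //; rewrite /h pickleK/= size_mkseq.
  split; first exact: cylinder_mkseq.
  move=> k _ i /andP[ni _]; apply/negP => hit; apply: nw.
  by exists i => //=; exact: ltnW.
have := probability_setC P mlim.
rewrite (measure_negligible (measurableC mlim) nullU) => /esym/eqP.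
by rewrite sube_eq ?fin_num_measure// add0e => /eqP ->.
Qed.

End DrivenChain.

(** * The Friedman walk *)

Section OneUrn.
Local Open Scope classical_set_scope.
Context {R : realType} {disp : measure_display} {T : measurableType disp}.
Variables (P : probability T R) (D : nat -> T -> bool).
Hypothesis urnD : friedman_urn P D.

Lemma draw_measurable n c : measurable [set w | D n w = c].
Proof.
have := friedman_urn_measurable urnD n measurableT (Y := [set c]).
by rewrite setTI; apply.
Qed.

Lemma foldl_count_draw h : foldl count_draw 0%N h = count id h.
Proof.
elim/last_ind: h => // h c IH.
by rewrite foldl_rcons IH -cats1 count_cat /= addn0.
Qed.

Lemma urn_cylinder_law h c : P (cylinder D (rcons h c))
  = (P (cylinder D h) * (draw_prob (size h) (foldl count_draw 0%N h) c)%:E)%E.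
Proof.
have mh := cylinder_measurable draw_measurable h.
have fin_cyl : P (cylinder D h) = (fine (P (cylinder D h)))%:E.
  by rewrite fineK// fin_num_measure.
have white : P (cylinder D (rcons h true)) =
    (P (cylinder D h) * (draw_prob (size h) (foldl count_draw 0%N h)
      true)%:E)%E.
  rewrite cylinder_rcons; have := friedman_urn_law urnD h.
  rewrite urn_afterE /= => ->; rewrite /white_prob foldl_count_draw.
  have e := count_predC id h.
  congr (_ * (_%:R / _%:R)%:E)%E; rewrite -e; last by rewrite addSn addnC.
  by rewrite -addnS addKn.
case: c => //; move: white; rewrite !cylinder_rcons => white.
have : P (cylinder D h) = (P (cylinder D h `&` [set w | D (size h) w = true]) +
    P (cylinder D h `&` [set w | D (size h) w = false]))%E.
  rewrite -measureU//; try by apply: measurableI => //; exact: draw_measurable.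
    rewrite -setIUr; congr (P _); apply/seteqP; split=> w; last by case.
    by move=> hw; split=> //=; case: (D _ w); [left|right].
  by apply/seteqP; split=> w //= [[_ ->] [_]].
rewrite white fin_cyl -EFinM.
have fin_black : P (cylinder D h `&` [set w | D (size h) w = false]) \is a
  fin_num.
  by rewrite fin_num_measure//; apply: measurableI => //;
    exact: draw_measurable.
rewrite -(fineK fin_black) -EFinD -EFinM => -[]; rewrite /draw_prob => e;
  congr EFin.
by rewrite mulrBr mulr1; lra.
Qed.

Definition white_count := state D count_draw 0%N.

Lemma walk1_eq0 n w : (walk1 D n w == 0) = at_origin n (white_count n w).
Proof.
rewrite /white_count /state foldl_count_draw /walk1 /white_draws /blue_draws
  /history.
rewrite subr_eq0 /at_origin eqz_nat -addnn.
by rewrite -[X in _ = (_ == X)](size_mkseq (D ^~ w) n) -(count_predC id)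
  eqn_add2l.
Qed.

Definition balanced_prob n : R :=
  expect_iter draw_prob count_draw n 0 (fun w => (at_origin n w)%:R) 0%N.

Lemma white_count_law n :
  P [set w | at_origin n (white_count n w)] = (balanced_prob n)%:E.
Proof. exact: (state_law draw_measurable urn_cylinder_law n (at_origin n)). Qed.

(** The sets of [sigma_process D] are the measurable sets of a measurable type
    on the same carrier, on which the draws are measurable by construction. *)
Lemma sigma_process_history n (Q : seq bool -> bool) :
  sigma_process D [set w | Q (mkseq (D ^~ w) n)].
Proof.
apply: (@history_measurable _
  (g_sigma_algebraType (\bigcup_n preimage_set_system [set: T] (D n)
    measurable))
  bool D).
move=> m c; apply: sub_sigma_algebra; exists m => //.
by exists [set c] => //; rewrite setTI.
Qed.

End OneUrn.

Section ManyUrns.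
Local Open Scope classical_set_scope.
Context {R : realType} {disp : measure_display} {T : measurableType disp}.
Variable P : probability T R.

Lemma walk_eq0 d (D : 'I_d -> nat -> T -> bool) n :
  [set w | walk D n w = 0]
  = [set w | [forall i, at_origin n (white_count (D i) n w)]].
Proof.
apply/seteqP; split=> w /=.
  move=> /rowP w0; apply/forallP => i; rewrite -walk1_eq0.
  by have := w0 i; rewrite !mxE => ->.
by move=> /forallP w0; apply/rowP => i; rewrite !mxE; apply/eqP;
  rewrite walk1_eq0.
Qed.

Lemma independent_urns d (D : 'I_d -> nat -> T -> bool) n
    (Q : 'I_d -> seq bool -> bool) : friedman_urns P D ->
  P [set w | [forall i, Q i (mkseq (D i ^~ w) n)]]
  = (\big[*%E/1%E]_i P [set w | Q i (mkseq (D i ^~ w) n)])%E.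
Proof.
move=> [_ indep].
have := indep [set: 'I_d]%SET (fun i => [set w | Q i (mkseq (D i ^~ w) n)]).
rewrite (eq_bigl xpredT); last by move=> i; rewrite inE.
move=> <-; last by move=> i _; exact: sigma_process_history.
congr (P _); apply/seteqP; split=> w /=; first by move=> /forallP H i _;
  exact: H.
by move=> H; apply/forallP => i; apply: H; rewrite /= inE.
Qed.

Lemma recurrent1 (D : 'I_1 -> nat -> T -> bool) :
  friedman_urns P D -> recurrent P (walk D) 0.
Proof.
move=> [urnD _]; rewrite /recurrent.
under eq_fun do rewrite walk_eq0.
have := visits_io (draw_measurable (urnD ord0)) (urn_cylinder_law (urnD ord0))
  (target := at_origin) (valid := fun n w => (w <= n)%N).
move=> <-//.
- congr (P (lim_sup_set _)); apply/funext => n; apply/seteqP; split=> w /=.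
    by move/forallP; apply.
  by move=> H; apply/forallP => i; rewrite (ord1 i).
- by move=> n s c sn; rewrite /count_draw -addn1 leq_add//; case: c.
- by move=> n s e; exact: avoid1_vanish.
Qed.

Lemma foldl_count_draw2 h u v : foldl count_draw2 (u, v) h
  = (foldl count_draw u (map fst h), foldl count_draw v (map snd h)).
Proof. by elim: h u v => [|c h IH] u v //=; rewrite -IH. Qed.

Lemma recurrent2 (D : 'I_2 -> nat -> T -> bool) :
  friedman_urns P D -> recurrent P (walk D) 0.
Proof.
move=> urns; have [urnD _] := urns; rewrite /recurrent.
under eq_fun do rewrite walk_eq0.
pose Z n w := (D ord0 n w, D ord_max n w).
have mkZ n w : mkseq (Z ^~ w) n = zip (mkseq (D ord0 ^~ w) n) (mkseq (D ord_max
  ^~ w) n).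
  by elim: n => // n IH; rewrite !mkseqS IH zip_rcons// !size_mkseq.
have mZ n c : measurable [set w | Z n w = c].
  case: c => a b; rewrite (_ : [set _ | _] =
    [set w | D ord0 n w = a] `&` [set w | D ord_max n w = b]).
    by apply: measurableI; exact: draw_measurable.
  by apply/seteqP; split=> w /=; rewrite /Z; [case=> -> ->|case=> -> ->].
have cylZ h : P (cylinder Z h)
    = (P (cylinder (D ord0) (map fst h)) * P (cylinder (D ord_max) (map snd
      h)))%E.
  have := independent_urns (size h) (fun i : 'I_2 =>
    if i == ord0 then pred1 (map fst h) else pred1 (map snd h)) urns.
  rewrite !big_ord_recl big_ord0 mule1 /=.
  have -> : lift ord0 ord0 = ord_max :> 'I_2 by apply: val_inj.
  have cylE (D' : nat -> T -> bool) g : size g = size h ->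
      [set w | mkseq (D' ^~ w) (size h) == g] = cylinder D' g.
    by move=> <-; apply/seteqP; split=> w /eqP.
  rewrite !cylE ?size_map// => <-; congr (P _); apply/seteqP; split=> w /=.
    rewrite /cylinder /= mkZ => e; apply/forallP => i; case: ifPn => i0.
      rewrite (eqP i0); apply/eqP.
      by have := congr1 unzip1 e; rewrite unzip1_zip// !size_mkseq.
    rewrite (_ : i = ord_max); last by apply: val_inj; case: i i0 => [[|[]]].
    by apply/eqP; have := congr1 unzip2 e; rewrite unzip2_zip// !size_mkseq.
  move=> /forallP H; rewrite /cylinder /= mkZ.
  move: (H ord0) (H ord_max) => /= /eqP-> /eqP->.
  exact: zip_unzip.
have lawZ h c : P (cylinder Z (rcons h c)) = (P (cylinder Z h) *
    (draw_prob2 (size h) (foldl count_draw2 (0, 0)%N h) c)%:E)%E.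
  rewrite !cylZ !map_rcons (urn_cylinder_law (urnD ord0)) (urn_cylinder_law
    (urnD ord_max)).
  by rewrite !size_map foldl_count_draw2 EFinM muleACA.
have := visits_io mZ lawZ (target := at_origin2) (valid := valid2).
move=> <-//.
- congr (P (lim_sup_set _)); apply/funext => n; apply/seteqP; split=> w /=.
    move=> /forallP H; rewrite /state mkZ foldl_count_draw2.
    rewrite [map _ _]unzip1_zip ?[map _ _]unzip2_zip ?size_mkseq//.
    by apply/andP; split; [exact: (H ord0)|exact: (H ord_max)].
  rewrite /state mkZ foldl_count_draw2.
  rewrite [map _ _]unzip1_zip ?[map _ _]unzip2_zip ?size_mkseq//.
  move=> /andP[/= H0 H1]; apply/forallP => i.
  have [->//|i0] := eqVneq i ord0.
  by rewrite (_ : i = ord_max)//; apply: val_inj; case: i i0 => [[|[]]].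
- by move=> n s c; exact: valid2_next.
- by move=> n s e; exact: avoid2_vanish.
Qed.

Lemma balanced_prob_ge0 n : 0 <= balanced_prob n :> R.
Proof. by apply: expect_iter_ge0 => [? ? ?|t]; rewrite ?draw_prob_ge0. Qed.

Lemma balanced_prob_le1 n : balanced_prob n <= 1 :> R.
Proof.
rewrite -(expect_iter_cst count_draw (@draw_prob_sum1 R) n 0 1 0%N).
apply: (expect_iter_le (@draw_prob_ge0 R) (valid := fun _ _ => True)) => // w _.
by case: at_origin.
Qed.

(** The constant is a square because a square root is taken next. *)
Lemma balanced_prob_decay n : (balanced_prob n : R) ^+ 2 * n.+1%:R <= 25.
Proof.
have [on|en] := boolP (odd n).
  rewrite /balanced_prob; have := return_odd (R := R) 0 on (n := 0).
  by rewrite addn0 => /(_ isT)->; rewrite expr0n mul0r.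
have -> : n = n./2.*2 by rewrite even_halfK.
have [->|n0] := posnP n./2.
  have := balanced_prob_le1 0; have := balanced_prob_ge0 0.
  move: (balanced_prob _) => x x0 x1; rewrite double0 mulr1; nra.
by apply: le_trans (return_upper n0) _; lra.
Qed.

(** A telescoping majorant: with [a = sqrt (n + 1)] and [b = sqrt (n + 2)],
    [1 / a - 1 / b = 1 / (a * b * (a + b))] is at least [1 / (2 * b ^+ 3)]. *)
Lemma balanced_prob_cube n :
  (balanced_prob n.+1 : R) ^+ 3
  <= 250 * ((Num.sqrt n.+1%:R)^-1 - (Num.sqrt n.+2%:R)^-1).
Proof.
have := balanced_prob_decay n.+1; have := balanced_prob_ge0 n.+1.
have : Num.sqrt n.+2%:R ^+ 2 = Num.sqrt n.+1%:R ^+ 2 + 1 :> R.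
  by rewrite !sqr_sqrtr ?natr1.
rewrite -{2}(@sqr_sqrtr R n.+2%:R)//.
have : 0 < Num.sqrt n.+1%:R :> R by rewrite sqrtr_gt0.
have : 0 < Num.sqrt n.+2%:R :> R by rewrite sqrtr_gt0.
move: (balanced_prob _) (Num.sqrt n.+1%:R) (Num.sqrt n.+2%:R) => x a b b0 a0 ba
  x0 xb.
have ab : a <= b by rewrite -ler_sqr ?nnegrE ?(ltW a0) ?(ltW b0)//; lra.
have xb0 : 0 <= x * b by rewrite mulr_ge0// ltW.
have xb5 : x * b <= 5.
  have : (x * b) ^+ 2 <= 5 ^+ 2 by rewrite exprMn; lra.
  by rewrite ler_sqr ?nnegrE.
have xb125 : x ^+ 3 * b ^+ 3 <= 125.
  rewrite -exprMn (_ : 125 = 5 ^+ 3); last by lra.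
  by rewrite lerXn2r// nnegrE.
have x3 : 0 <= x ^+ 3 by rewrite exprn_ge0.
have -> : a^-1 - b^-1 = (b - a) / (a * b) by field; rewrite !gt_eqF.
rewrite mulrA ler_pdivlMr ?mulr_gt0//.
rewrite -(ler_pM2r (addr_gt0 b0 a0)).
have -> : 250 * (b - a) * (b + a) = 250.
  by rewrite -mulrA (_ : (b - a) * (b + a) = 1) ?mulr1//; lra.
apply: (@le_trans _ _ (2 * (x ^+ 3 * b ^+ 3))); last by lra.
rewrite -[leLHS]mulrA [leRHS]mulrCA ler_wpM2l//.
have -> : 2 * b ^+ 3 = b ^+ 2 * (2 * b) by ring.
apply: ler_pM; last by lra.
- by rewrite mulr_ge0// ltW.
- by rewrite addr_ge0// ltW.
- by rewrite expr2 ler_wpM2r// ltW.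
Qed.

(** The coordinates are at the origin together with probability of order at
    most [n ^ (- 3 / 2)], so the first Borel-Cantelli lemma applies. *)
Lemma transient3 d (D : 'I_d -> nat -> T -> bool) : (3 <= d)%N ->
  friedman_urns P D -> transient P (walk D) 0.
Proof.
move=> d3 urns; have [urnD _] := urns; rewrite /transient /recurrent.
have zero_law n : P [set w | walk D n w = 0] = (balanced_prob n ^+ d)%:E.
  rewrite walk_eq0.
  rewrite (independent_urns n (fun _ h => at_origin n (foldl count_draw 0%N h))
    urns).
  under eq_bigr => i _ do rewrite (white_count_law (urnD i)).
  by rewrite prodEFin prodr_const card_ord.
rewrite lim_sup_set_cvg0; first by move=> /eqP; rewrite eq_sym onee_eq0.
- move=> n; rewrite walk_eq0.
  rewrite (_ : [set _ | _] = \bigcap_(i in [set: 'I_d])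
      [set w | at_origin n (white_count (D i) n w)]).
    apply: fin_bigcap_measurable => [|i _]; first exact: finite_finset.
    exact: (state_measurable _ _ (draw_measurable (urnD i))).
  apply/seteqP; split=> w /=; first by move=> /forallP H i _; exact: H.
  by move=> H; apply/forallP => i; exact: H.
rewrite (eq_eseriesr (g := fun n => (balanced_prob n ^+ d)%:E)); last first.
  by move=> n _; exact: zero_law.
apply: (@le_lt_trans _ _ 251%:E); last exact: ltry.
apply: lime_le.
  by apply: is_cvg_nneseries => n _ _; rewrite lee_fin exprn_ge0//
    balanced_prob_ge0.
apply: nearW => N; rewrite sumEFin lee_fin.
apply: (@le_trans _ _ (\sum_(0 <= n < N.+1) balanced_prob n ^+ d)).
  by rewrite big_nat_recr//= lerDl exprn_ge0// balanced_prob_ge0.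
apply: (@le_trans _ _ (251 - 250 / Num.sqrt N.+1%:R)); last first.
  by rewrite gerBl divr_ge0.
elim: N => [|N IH].
  rewrite big_nat1 sqrtr1 divr1.
  have -> : 251 - 250 = 1 :> R by lra.
  by rewrite exprn_ile1 ?balanced_prob_ge0 ?balanced_prob_le1.
rewrite big_nat_recr//=.
have h : balanced_prob N.+1 ^+ d <= balanced_prob N.+1 ^+ 3 :> R.
  by rewrite ler_wiXn2l ?balanced_prob_ge0 ?balanced_prob_le1.
have := balanced_prob_cube N; lra.
Qed.

End ManyUrns.

Theorem theorem4p1 (R : realType) (disp : measure_display)
    (T : measurableType disp) (P : probability T R)
    (d : nat) (hd : (1 <= d)%N)
    (D : 'I_d -> nat -> T -> bool) (hD : friedman_urns P D) :
  (d = 1%N \/ d = 2%N -> recurrent P (walk D) 0) /\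
  ((3 <= d)%N -> transient P (walk D) 0).
Proof.
split; last by move=> d3; exact: transient3.
by case=> dE; subst d; [exact: recurrent1|exact: recurrent2].
Qed.
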